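(* Let $p\in(1,\infty]$, $\xi\in L^p(\mathcal F_T)^d$ and $F:\mathbb S^p\times\mathbb M^p_0\to\mathbb S^p_0$. Assume that for all $y\in L^p(\mathcal F_0)^d$ and $M\in\mathbb M^p_0$, the equation $$Y_t=y-F_t(Y,M)-M_t,\qquad t\in[0,T],$$ has a unique solution $Y\in\mathbb S^p$. For $V\in L^p(\mathcal F_T)^d$ set $y^V:=\mathbb E_0V\in L^p(\mathcal F_0)^d$ and $M^V_t:=\mathbb E_0V-\mathbb E_tV$ (so that $M^V\in\mathbb M^p_0$), and let $Y^V\in\mathbb S^p$ be the unique solution of $Y_t=y^V-F_t(Y,M^V)-M^V_t$, $t\in[0,T]$. Define $$G:L^p(\mathcal F_T)^d\to L^p(\mathcal F_T)^d,\quad G(V):=\xi+F_T(Y^V,M^V),$$ $$\pi:\mathbb S^p\times\mathbb M^p_0\to L^p(\mathcal F_T)^d,\quad \pi(Y,M):=Y_0-M_T,\qquad \phi:L^p(\mathcal F_T)^d\to\mathbb S^p\times\mathbb M^p_0,\quad \phi(V):=(Y^V,M^V).$$ Consider the backward stochastic equation (BSE) $$Y_t+F_t(Y,M)+M_t=\xi+F_T(Y,M)+M_T\quad\text{for all }t\in[0,T].\qquad( * )$$ Then the following hold: a) $V=(\pi\circ\phi)(V)$ for all $V\in L^p(\mathcal F_T)^d$. In particular, $\phi$ is injective. b) If $V\in L^p(\mathcal F_T)^d$ is a fixed point of $G$, then $\phi(V)$ is a solution of the BSE $( * )$. c) If $(Y,M)\in\mathbb S^p\times\mathbb M^p_0$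 solves the BSE $( * )$, then $\pi(Y,M)$ is a fixed point of $G$ and $(Y,M)=(\phi\circ\pi)(Y,M)$. d) $V$ is a unique fixed point of $G$ in $L^p(\mathcal F_T)^d$ if and only if $\phi(V)$ is a unique solution of the BSE $( * )$ in $\mathbb S^p\times\mathbb M^p_0$.
   Context: Fix a finite time horizon $T\in[0,\infty)$, a dimension $d\in\mathbb N$ and a filtered probability space $(\Omega,\mathcal F,\mathbb F,\mathbb P)$ whose filtration $\mathbb F=(\mathcal F_t)_{t\in[0,T]}$ satisfies the usual conditions; all martingales are taken in their RCLL (right-continuous with left limits) modification. $|\cdot|$ is the Euclidean norm. For a $d$-dimensional random vector $X$, $\|X\|_p:=(\mathbb E|X|^p)^{1/p}$ if $p<\infty$ and $\|X\|_\infty:=\operatorname{ess\,sup}_{\omega\in\Omega}|X|$. For $p\in(1,\infty]$: - $L^p(\mathcal F_t)^d$ is the set of $d$-dimensional $\mathcal F_t$-measurable random vectors $X$ with $\|X\|_p<\infty$; $\mathbb E_tX:=\mathbb E[X\mid\mathcal F_t]$; - $\mathbb S^p$ is the set of $\mathbb R^d$-valued RCLL adapted processes $(Y_t)_{0\le t\le T}$ with $\|Y\|_{\mathbb S^p}:=\|\sup_{0\le t\le T}|Y_t|\|_p<\infty$; $\mathbb S^p_0:=\{Y\in\mathbb S^p:Y_0=0\}$; $\mathbb M^p_0$ is the set of all martingales in $\mathbb S^p_0$. For a map $F$ into $\mathbb S^p_0$, $F_t(Y,M)$ denotes the value at time $t$ of the process $F(Y,M)$. A solution of the BSE with generator $F$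 and terminal condition $\xi$ is a pair $(Y,M)\in\mathbb S^p\times\mathbb M^p_0$ satisfying the equation for all $t\in[0,T]$. *)

(* Defs.v *)
From HB Require Import structures.
From mathcomp Require Import all_boot all_order all_algebra.
From mathcomp Require Import generic_quotient.
From mathcomp Require Import all_classical all_reals all_analysis.

Set Implicit Arguments.
Unset Strict Implicit.
Unset Printing Implicit Defensive.

Import Order.TTheory GRing.Theory Num.Theory.
Import numFieldNormedType.Exports.

Local Open Scope classical_set_scope.
Local Open Scope ring_scope.
Local Open Scope quotient_scope.

(* Random vectors are identified when they agree almost surely, and processes
   when they are indistinguishable on [0, T].  Both quotients are taken over all
   functions; measurability, path regularity and integrability are imposed by
   the subsets Lp, Sp, Sp0 and Mp0 below, which consist of the classes having a
   representative with the required properties. *)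
Section random_vectors.
Context (R : realType) (d : measure_display) (Omega : measurableType d)
  (P : probability Omega R) (n : nat).

Definition as_eq : rel (Omega -> 'rV[R]_n) :=
  fun X Y => `[< {ae P, forall w, X w = Y w} >].

Let as_eq_refl : reflexive as_eq.
Proof. by move=> X; apply/asboolP; exact: aeW. Qed.

Let as_eq_sym : symmetric as_eq.
Proof.
by move=> X Y; apply/asboolP/asboolP; apply: filterS => w ->.
Qed.

Let as_eq_trans : transitive as_eq.
Proof.
move=> Y X Z /asboolP XY /asboolP YZ; apply/asboolP.
by apply: filterS2 XY YZ => w -> ->.
Qed.

Canonical as_eq_equiv := EquivRel as_eq as_eq_refl as_eq_sym as_eq_trans.

Definition rvec : Type := {eq_quot as_eq}.
HB.instance Definition _ := Choice.on rvec.
HB.instance Definition _ := EqQuotient.on rvec.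
Definition rvec_to_fun (X : rvec) : Omega -> 'rV[R]_n := repr X.
Coercion rvec_to_fun : rvec >-> Funclass.

Definition rvec_class (X : Omega -> 'rV[R]_n) : rvec := \pi_rvec X.

End random_vectors.

Arguments rvec_class {R d Omega} P {n} X.

Section processes.
Context (R : realType) (d : measure_display) (Omega : measurableType d)
  (P : probability Omega R) (T : R) (n : nat).

Definition indist : rel (R -> Omega -> 'rV[R]_n) := fun X Y =>
  `[< {ae P, forall w, forall t, 0 <= t <= T -> X t w = Y t w} >].

Let indist_refl : reflexive indist.
Proof. by move=> X; apply/asboolP; exact: aeW. Qed.

Let indist_sym : symmetric indist.
Proof.
move=> X Y; apply/asboolP/asboolP; apply: filterS => w XY t tT;
by rewrite XY.
Qed.

Let indist_trans : transitive indist.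
Proof.
move=> Y X Z /asboolP XY /asboolP YZ; apply/asboolP.
by apply: filterS2 XY YZ => w XY YZ t tT; rewrite XY// YZ.
Qed.

Canonical indist_equiv := EquivRel indist indist_refl indist_sym indist_trans.

Definition process : Type := {eq_quot indist}.
HB.instance Definition _ := Choice.on process.
HB.instance Definition _ := EqQuotient.on process.
Definition process_to_fun (Y : process) : R -> Omega -> 'rV[R]_n := repr Y.
Coercion process_to_fun : process >-> Funclass.

Definition process_class (Y : R -> Omega -> 'rV[R]_n) : process :=
  \pi_process Y.

End processes.

Arguments process_class {R d Omega} P T {n} Y.

Section quotient_facts.
Context (R : realType) (d : measure_display) (Omega : measurableType d)
  (P : probability Omega R) (T : R) (n : nat).

Lemma rvec_classP (X Y : Omega -> 'rV[R]_n) :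
  rvec_class P X = rvec_class P Y <-> {ae P, forall w, X w = Y w}.
Proof.
by split=> [/eqmodP/asboolP//|XY]; apply/eqmodP/asboolP.
Qed.

Lemma rvec_classK (X : rvec P n) : rvec_class P X = X.
Proof. exact: reprK. Qed.

Lemma process_classP (X Y : R -> Omega -> 'rV[R]_n) :
  process_class P T X = process_class P T Y <->
  {ae P, forall w, forall t, 0 <= t <= T -> X t w = Y t w}.
Proof.
by split=> [/eqmodP/asboolP//|XY]; apply/eqmodP/asboolP.
Qed.

Lemma process_classK (Y : process P T n) : process_class P T Y = Y.
Proof. exact: reprK. Qed.

End quotient_facts.

Section filtration.
Context (R : realType) (d : measure_display) (Omega : measurableType d)
  (P : probability Omega R).

(* As FF 0 consists of measurable sets, usual_complete also makes P complete. *)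
Record usual_filtration (T : R) (FF : R -> set (set Omega)) : Prop := {
  filtration_sigma_algebra :
    forall t, 0 <= t <= T -> sigma_algebra [set: Omega] (FF t) ;
  filtration_measurable :
    forall t, 0 <= t <= T -> FF t `<=` measurable ;
  filtration_mono :
    forall s t, 0 <= s -> s <= t -> t <= T -> FF s `<=` FF t ;
  usual_right_continuous :
    forall t, 0 <= t < T -> \bigcap_(s in [set s | t < s <= T]) FF s `<=` FF t ;
  usual_complete : forall N, P.-negligible N -> FF 0 N
}.

End filtration.

Section spaces.
Context (R : realType) (d : measure_display) (Omega : measurableType d)
  (P : probability Omega R) (n : nat).
Implicit Types (G : set (set Omega)) (p : \bar R).

Definition enorm (x : 'rV[R]_n) : R := Num.sqrt (\sum_(i < n) x ord0 i ^+ 2).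

Definition sub_measurable G (X : Omega -> 'rV[R]_n) : Prop :=
  forall i : 'I_n,
    preimage_set_system setT (fun w => X w ord0 i) measurable `<=` G.

Definition Lp G p : set (rvec P n) :=
  rvec_class P @` [set X | sub_measurable G X /\
    ('N[P]_p[EFin \o enorm \o X] < +oo)%E].

(* X is a version of the conditional expectation of V given G. *)
Definition is_condexp G (V X : Omega -> 'rV[R]_n) : Prop :=
  [/\ sub_measurable G X,
      forall i : 'I_n, P.-integrable setT (fun w => (X w ord0 i)%:E) &
      forall (i : 'I_n) (A : set Omega), G A ->
        (\int[P]_(w in A) (X w ord0 i)%:E = \int[P]_(w in A) (V w ord0 i)%:E)%E].

(* The junk value 0 is taken only when there is no version. *)
Definition condexp G (V : rvec P n) : rvec P n :=
  xget (rvec_class P (fun=> 0)) (rvec_class P @` is_condexp G V).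

Context (T : R) (FF : R -> set (set Omega)).

Definition rcll (x : R -> 'rV[R]_n) : Prop :=
  (forall t, 0 <= t < T -> x s @[s --> t^'+] --> x t) /\
  (forall t, 0 < t <= T -> cvg (x s @[s --> t^'-])).

Definition adapted (X : R -> Omega -> 'rV[R]_n) : Prop :=
  forall t, 0 <= t <= T -> sub_measurable (FF t) (X t).

(* The case s = t gives adaptedness and integrability. *)
Definition martingale (X : R -> Omega -> 'rV[R]_n) : Prop :=
  forall s t, 0 <= s -> s <= t -> t <= T -> is_condexp (FF s) (X t) (X s).

Definition sup_enorm (X : R -> Omega -> 'rV[R]_n) (w : Omega) : \bar R :=
  ereal_sup [set (enorm (X t w))%:E | t in [set t | 0 <= t <= T]].

Definition Sp p : set (process P T n) :=
  process_class P T @` [set X | [/\ forall w, rcll (fun t => X t w),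
    adapted X & ('N[P]_p[sup_enorm X] < +oo)%E]].

Definition Sp0 p : set (process P T n) :=
  Sp p `&` [set Y : process P T n | {ae P, forall w, Y 0 w = 0}].

Definition Mp0 p : set (process P T n) :=
  Sp0 p `&` process_class P T @` martingale.

End spaces.

Section bse.
Context (R : realType) (d : measure_display) (Omega : measurableType d)
  (P : probability Omega R) (n : nat) (T : R) (FF : R -> set (set Omega))
  (p : \bar R).
Variable F : process P T n * process P T n -> process P T n.
Variable xi : rvec P n.

Definition forward_solution (y : rvec P n) (M : process P T n) :
    set (process P T n) :=
  Sp FF p `&` [set Y : process P T n | {ae P, forall w, forall t, 0 <= t <= T ->
    Y t w = y w - F (Y, M) t w - M t w}].

Definition bse_solution : set (process P T n * process P T n) :=
  (Sp FF p `*` Mp0 FF p) `&`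
  [set YM : process P T n * process P T n | {ae P, forall w, forall t, 0 <= t <= T ->
    YM.1 t w + F YM t w + YM.2 t w = xi w + F YM T w + YM.2 T w}].

(* M is the RCLL modification of t |-> E_0 V - E_t V; by usual_complete every
   modification is adapted, so requiring an adapted representative is harmless. *)
Definition is_MV (V : rvec P n) (M : process P T n) : Prop :=
  (process_class P T @` [set X : R -> Omega -> 'rV[R]_n |
     (forall w, rcll T (fun t => X t w)) /\ adapted T FF X]) M /\
  forall t, 0 <= t <= T ->
    {ae P, forall w, M t w = condexp (FF 0) V w - condexp (FF t) V w}.

Variable MV : rvec P n -> process P T n.

Definition YV (V : rvec P n) : process P T n :=
  xget (process_class P T (fun _ _ => 0))
    (forward_solution (condexp (FF 0) V) (MV V)).

Definition phi_map (V : rvec P n) : process P T n * process P T n :=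
  (YV V, MV V).

Definition G_map (V : rvec P n) : rvec P n :=
  rvec_class P (fun w => xi w + F (YV V, MV V) T w).

Definition pi_map (YM : process P T n * process P T n) : rvec P n :=
  rvec_class P (fun w => YM.1 0 w - YM.2 T w).

End bse.

(* Main.v *)
Require Import Defs.
From HB Require Import structures.
From mathcomp Require Import all_boot all_order all_algebra.
From mathcomp Require Import all_classical all_reals all_analysis.
From mathcomp Require Import measurable_realfun ess_sup_inf ring lra.

Import Order.TTheory GRing.Theory Num.Theory.
Import numFieldNormedType.Exports.
Local Open Scope classical_set_scope.
Local Open Scope ring_scope.

Set Implicit Arguments.
Unset Strict Implicit.
Unset Printing Implicit Defensive.

(** The maps [phi] and [pi] are inverse to each other between the fixed points
    of [G] and the solutions of the backward equation.  Given [V], the forward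
    solution starts from [E_0 V] and is driven by the martingale
    [M_t = E_0 V - E_t V], hence [Y_0 - M_T = E_T V = V], which is a).  Since
    [Y_t + F_t + M_t] is the constant [E_0 V = V + M_T], the backward equation
    says that [V = xi + F_T], which is b).  Conversely a solution [(Y, M)]
    determines [V = Y_0 - M_T]; the martingale property gives
    [E_t V = Y_0 - M_t], so that [M] is the martingale attached to [V], and
    uniqueness of the forward solution gives [Y], which is c).  Part d) is the
    resulting bijection.  This is carried out in [pi_phi], [fixed_point_bse] and
    [bse_fixed_point].

    The analytic content is that these maps are well defined, in particular
    that the martingale attached to [V] belongs to the space of martingales with
    supremum in L^p ([MV_Mp0]).  This needs the existence, uniqueness and
    contraction properties of conditional expectations ([condexp_scalar_exists],
    [condexp_unique], [condexp_l1_contract]) and Doob's inequality in L^p.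

    Doob's inequality is derived from a deterministic one ([runmax_powR]): for
    nonnegative samples [s_0, ..., s_(n-1)] with running maxima [a_0 = 0, a_1,
    ..., a_n], the maximum moves only when the current sample is at least the
    new maximum, so convexity yields
    [(r - 1) a_n^r <= r \sum_j (a_(j+1)^(r-1) - a_j^(r-1)) s_j].  Each weight is
    nonnegative and known at time [j], so in the mean [s_j] may be replaced by
    the terminal value [v]; the sum telescopes to [r a_n^(r-1) v], and splitting
    this product bounds the moment of [a_n] by that of [v] ([doob_runmax]).
    Right continuity and Fatou's lemma extend the bound to the supremum over
    all times ([limsup_maximal_Lnorm], [rcll_dominated_sup]). *)

(** * Norms and integrability *)

Section norms.
Context {R : realType} {d : measure_display} {Omega : measurableType d}.
Variable P : {measure set Omega -> \bar R}.

(** Both integrals are suprema over the simple functions lying below the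
    integrand.  The lemma is applied to the supremum of a process over all
    times, which is an uncountable supremum of measurable functions. *)
Lemma le_nonneg_integral (f g : Omega -> \bar R) :
  (forall w, 0 <= f w)%E -> (forall w, f w <= g w)%E ->
  (\int[P]_w f w <= \int[P]_w g w)%E.
Proof.
move=> f0 fg; have g0 w : (0 <= g w)%E := le_trans (f0 w) (fg w).
rewrite !ge0_integralTE//; apply: le_ereal_sup => _ [h hf <-].
by exists h => // w; exact: le_trans (hf w) (fg w).
Qed.

Lemma le_Lnorm (p : \bar R) (f g : Omega -> \bar R) : (0 <= p)%E ->
  (forall w, `|f w| <= `|g w|)%E -> ('N[P]_p[f] <= 'N[P]_p[g])%E.
Proof.
move=> p0 fg; rewrite unlock; case: p p0 => [r|_|//].
  rewrite lee_fin => r0; apply: gt0_ler_poweR.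
  - by rewrite invr_ge0.
  - by rewrite in_itv/= leey andbT; apply: integral_ge0 => w _; exact: poweR_ge0.
  - by rewrite in_itv/= leey andbT; apply: integral_ge0 => w _; exact: poweR_ge0.
  apply: le_nonneg_integral => w; first exact: poweR_ge0.
  by apply: gt0_ler_poweR => //; rewrite in_itv/= leey andbT.
by case: ifPn => // _; apply: le_ess_sup; apply/nearW.
Qed.

(** Unlike the equivalent Euclidean norm, it is additive over the coordinates, so
    that estimates on vectors are sums of estimates on scalars. *)
Definition l1norm {n} (x : 'rV[R]_n) : R := \sum_(i < n) `|x ord0 i|.

Lemma l1norm_ge0 n (x : 'rV[R]_n) : 0 <= l1norm x.
Proof. exact: sumr_ge0. Qed.

Lemma l1normB n (x y : 'rV[R]_n) : l1norm (x - y) <= l1norm x + l1norm y.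
Proof.
rewrite /l1norm -big_split/=; apply: ler_sum => i _.
by rewrite !mxE (le_trans (ler_normD _ _))// normrN.
Qed.

Lemma l1normD n (x y : 'rV[R]_n) : l1norm (x + y) <= l1norm x + l1norm y.
Proof.
rewrite /l1norm -big_split/=; apply: ler_sum => i _.
by rewrite !mxE ler_normD.
Qed.

Lemma l1norm0_eq0 n (x : 'rV[R]_n) : l1norm x = 0 -> x = 0.
Proof.
move=> x0; apply/rowP => i; rewrite mxE; apply/eqP; rewrite -normr_eq0 eq_le.
rewrite normr_ge0 andbT -x0 /l1norm (bigD1 i)//= lerDl.
exact: sumr_ge0.
Qed.

Lemma enorm_ge0 n (x : 'rV[R]_n) : 0 <= enorm x.
Proof. exact: sqrtr_ge0. Qed.

Lemma norm_le_enorm n (x : 'rV[R]_n) i : `|x ord0 i| <= enorm x.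
Proof.
rewrite /enorm -sqrtr_sqr ler_sqrt; last by apply: sumr_ge0 => j _; exact: sqr_ge0.
by rewrite (bigD1 i)//= lerDl; apply: sumr_ge0 => j _; exact: sqr_ge0.
Qed.

Lemma enorm_le_l1norm n (x : 'rV[R]_n) : enorm x <= l1norm x.
Proof.
rewrite -[leRHS]ger0_norm ?l1norm_ge0// -sqrtr_sqr ler_sqrt ?sqr_ge0//.
rewrite expr2 {2}/l1norm mulr_sumr; apply: ler_sum => i _.
rewrite -real_normK ?num_real// expr2 ler_wpM2r// /l1norm (bigD1 i)//= lerDl.
exact: sumr_ge0.
Qed.

End norms.

Section Lp_representatives.
Context {R : realType} {d : measure_display} {Omega : measurableType d}
  {P : probability Omega R} {n : nat}.
Implicit Types (G : set (set Omega)) (p : \bar R).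

Lemma sub_measurable_fun G (X : Omega -> 'rV[R]_n) i :
  G `<=` measurable -> sub_measurable G X ->
  measurable_fun setT (fun w => X w ord0 i).
Proof.
by move=> Gm GX _ B mB; apply: Gm; apply: (GX i); exists B.
Qed.

Lemma measurable_l1norm (X : Omega -> 'rV[R]_n) :
  (forall i, measurable_fun setT (fun w => X w ord0 i)) ->
  measurable_fun setT (fun w => l1norm (X w)).
Proof.
by move=> mX; apply: measurable_sum => i; exact: measurableT_comp.
Qed.

(** Together with [Lfun_enorm], this lets L^p-membership of vectors be checked
    on the real function [l1norm], for which Minkowski's inequality is at
    hand. *)
Lemma l1norm_Lfun p (X : Omega -> 'rV[R]_n) : (1 <= p)%E ->
  (forall i, measurable_fun setT (fun w => X w ord0 i)) ->
  ('N[P]_p[EFin \o @enorm R n \o X] < +oo)%E ->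
  (fun w => l1norm (X w)) \in Lfun P p.
Proof.
move=> p1 mX fX; have p0 : (0 <= p)%E by rewrite (le_trans _ p1).
have -> : (fun w => l1norm (X w)) = \sum_(i < n) (fun w => `|X w ord0 i|).
  by apply/funext => w; rewrite fct_sumE.
have [L0 LD] := Lfun_addr_closed P p1.
apply: (big_ind (fun f => f \in Lfun P p)) => // i _.
rewrite inE; apply/andP; split; rewrite inE/=.
  exact: measurableT_comp.
apply: le_lt_trans fX; apply: le_Lnorm => // w /=.
by rewrite lee_fin normr_id (ger0_norm (enorm_ge0 _)) norm_le_enorm.
Qed.

Lemma Lfun_enorm p (X : Omega -> 'rV[R]_n) (u : Omega -> R) : (0 <= p)%E ->
  (forall w, l1norm (X w) <= u w) -> u \in Lfun P p ->
  ('N[P]_p[EFin \o @enorm R n \o X] < +oo)%E.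
Proof.
move=> p0 Xu; rewrite inE => /andP[_]; rewrite inE/= => fu.
apply: le_lt_trans fu; apply: le_Lnorm => // w /=; rewrite lee_fin.
rewrite (ger0_norm (enorm_ge0 _)).
exact: le_trans (enorm_le_l1norm _) (le_trans (Xu w) (ler_norm _)).
Qed.

End Lp_representatives.

(** * Sub-sigma-algebras *)

(** A sub-sigma-algebra [G] is turned into the measurable type [GT], with the
    same points as [Omega], so that measurability with respect to [G] is
    measurability of functions on [GT]. *)
Section sub_sigma_algebra.
Context {R : realType} {d : measure_display} {Omega : measurableType d}
  (P : probability Omega R) (G : set (set Omega)).
Hypothesis Gsig : sigma_algebra setT G.
Hypothesis Gm : G `<=` measurable.

Local Notation GT := (g_sigma_algebraType G).
Import HBNNSimple.

Lemma measurable_subE (A : set GT) : measurable A = G A.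
Proof. by rewrite measurable_g_measurableTypeE. Qed.

Lemma sub_setU (A B : set Omega) : G A -> G B -> G (A `|` B).
Proof.
by move=> GA GB; rewrite -measurable_subE; apply: measurableU;
  rewrite measurable_subE.
Qed.

Lemma sub_setD (A B : set Omega) : G A -> G B -> G (A `\` B).
Proof.
by move=> GA GB; rewrite -measurable_subE; apply: measurableD;
  rewrite measurable_subE.
Qed.

Lemma sub_setI (A B : set Omega) : G A -> G B -> G (A `&` B).
Proof.
by move=> GA GB; rewrite -measurable_subE; apply: measurableI;
  rewrite measurable_subE.
Qed.

Lemma measurable_sub_fun (f : GT -> R) :
  measurable_fun setT f -> measurable_fun setT (f : Omega -> R).
Proof. by move=> mf _ B mB; apply: Gm; rewrite -measurable_subE; exact: mf. Qed.

Lemma sub_measurableP n (X : Omega -> 'rV[R]_n) :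
  sub_measurable G X <->
  forall i, measurable_fun setT ((fun w => X w ord0 i) : GT -> R).
Proof.
split=> [GX i _ B mB|mX i _ [B mB <-]]; last by rewrite -measurable_subE; exact: mX.
by rewrite measurable_subE; apply: (GX i); exists B.
Qed.

(** An inequality between the integrals over all the sets of [G] says that, in
    conditional mean given [G], [z] is at most [v]; hence it survives
    multiplication by a nonnegative [G]-measurable weight.  The weight is
    approximated from below by simple functions. *)
Lemma le_weighted_integral (z v : Omega -> R) (W : GT -> R) :
  measurable_fun setT z -> (forall w, 0 <= z w) ->
  measurable_fun setT v -> (forall w, 0 <= v w) ->
  (forall A, G A -> \int[P]_(w in A) (z w)%:E <= \int[P]_(w in A) (v w)%:E)%E ->
  measurable_fun setT W -> (forall w, 0 <= W w) ->
  (\int[P]_w (W w * z w)%:E <= \int[P]_w (W w * v w)%:E)%E.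
Proof.
move=> mz z0 mv v0 zv mW W0.
have mWE : measurable_fun (setT : set GT) (EFin \o W) by exact/measurable_EFinP.
pose h := nnsfun_approx measurableT mWE.
have mh k : measurable_fun setT (h k : Omega -> R).
  by apply: measurable_sub_fun; exact: measurable_funP.
have hW w : (h k w)%:E @[k --> \oo] --> (W w)%:E.
  by apply: (cvg_nnsfun_approx measurableT mWE) => // u _; rewrite lee_fin.
have ndh w : {homo (fun k => h k w) : k l / (k <= l)%N >-> k <= l}.
  by move=> k l kl; exact/lefP/nd_nnsfun_approx.
have cvgh (g : Omega -> R) : measurable_fun setT g -> (forall w, 0 <= g w) ->
    (\int[P]_w (h k w * g w)%:E @[k --> \oo] --> \int[P]_w (W w * g w)%:E)%E.
  move=> mg g0.
  have -> : (\int[P]_w (W w * g w)%:E =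
      \int[P]_w (limn (fun k => (h k w * g w)%:E)))%E.
    apply: eq_integral => w _; apply/esym/cvg_lim => //.
    by under eq_fun do rewrite EFinM; rewrite EFinM; apply: cvgeZr.
  apply: cvg_monotone_convergence => // [k|k w _|w _ k l kl].
  - by apply/measurable_EFinP; exact: measurable_funM.
  - by rewrite lee_fin mulr_ge0.
  - by rewrite lee_fin ler_wpM2r// ndh.
apply: (lee_cvg_to (cvgh _ mz z0) (cvgh _ mv v0)); apply: nearW => k /=.
(* On simple functions the comparison is the hypothesis on each level set. *)
have hE (g : Omega -> R) : measurable_fun setT g -> (forall w, 0 <= g w) ->
    (\int[P]_w (h k w * g w)%:E =
     \sum_(y \in range (h k)) y%:E * \int[P]_(w in h k @^-1` [set y]) (g w)%:E)%E.
  move=> mg g0.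
  transitivity (\int[P]_w (\sum_(y \in range (h k))
      (y * \1_(h k @^-1` [set y]) w * g w)%:E))%E.
    apply: eq_integral => w _; rewrite fsumEFin//; congr EFin.
    by rewrite {1}(fimfunE (h k)) mulr_fsuml.
  have mI y : measurable (h k @^-1` [set y] : set Omega).
    by apply: Gm; rewrite -measurable_subE; exact: measurable_funPTI.
  rewrite ge0_integral_fsum//=.
  - apply: eq_fsbigr => y /set_mem[u _ <-].
    under eq_integral do rewrite -mulrA EFinM.
    rewrite ge0_integralZl//=; last 3 first.
    + by apply/measurable_EFinP; exact: measurable_funM.
    + by move=> w _; rewrite lee_fin mulr_ge0.
    + by rewrite lee_fin.
    congr (_ * _)%E; rewrite [RHS]integral_mkcond.
    apply: eq_integral => w _; rewrite patchE indicE.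
    by case: ifPn => _; rewrite ?mul1r ?mul0r.
  - move=> y;  apply/measurable_EFinP; apply: measurable_funM => //.
    exact: measurable_funM.
  - move=> y w _; rewrite EFinM mule_ge0 ?lee_fin//.
    exact: nnfun_muleindic_ge0.
rewrite !hE//; apply: lee_fsum => // y [w _ <-].
apply: lee_wpmul2l; first by rewrite lee_fin.
by apply: zv; rewrite -measurable_subE; exact: measurable_funPTI.
Qed.

End sub_sigma_algebra.

(** * A pathwise maximal inequality *)

Section powR_inequalities.
Context {R : realType}.
Implicit Types (r a b s x y : R).

Lemma powR_predM r x : 1 < r -> 0 <= x -> x `^ (r - 1) * x = x `^ r.
Proof. by move=> r1 x0; rewrite mulrC mulr_powRB1// (lt_trans _ r1). Qed.

(** Young's inequality with exponents [r] and [r / (r - 1)]; equivalently, the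
    graph of [x `^ r] lies above its tangent at [a]. *)
Lemma powR_tangent r a b : 1 < r -> 0 <= a -> 0 <= b ->
  r * (a `^ (r - 1) * b) <= b `^ r + (r - 1) * a `^ r.
Proof.
move=> r1 a0 b0; have r0 : 0 < r by rewrite (lt_trans _ r1).
have r10 : 0 < r - 1 by rewrite subr_gt0.
have := @conjugate_powR R b (a `^ (r - 1)) r (r / (r - 1)) b0 (powR_ge0 _ _) r0.
rewrite divr_gt0// => /(_ erefl).
have -> : r^-1 + (r / (r - 1))^-1 = 1.
  by rewrite invf_div -{1}[r^-1]mul1r -mulrDl subrKC divff// gt_eqF.
move=> /(_ erefl); rewrite -powRrM mulrC [(r - 1) * _]mulrC divfK ?gt_eqF//.
rewrite -(ler_pM2l r0) => /le_trans; apply.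
rewrite mulrDr mulrCA divff ?gt_eqF// mulr1 lerD2l.
by rewrite invf_div mulrCA [r * _]mulrC divfK ?gt_eqF// mulrC.
Qed.

(** One step of the pathwise inequality: [a] and [b] are two successive values
    of a running maximum, which moves only when the new sample [s] is at least
    the new maximum. *)
Lemma powR_increment r a b s : 1 < r -> 0 <= a -> a <= b -> (a < b -> b <= s) ->
  (r - 1) * (b `^ r - a `^ r) <= r * ((b `^ (r - 1) - a `^ (r - 1)) * s).
Proof.
move=> r1 a0; rewrite le_eqVlt => /predU1P[<- _|ab /(_ ab) bs].
  by rewrite !subrr mul0r !mulr0.
have b0 : 0 <= b by rewrite (le_trans a0)// ltW.
have r10 : 0 <= r - 1 by rewrite subr_ge0 ltW.
have w0 : 0 <= b `^ (r - 1) - a `^ (r - 1).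
  by rewrite subr_ge0 ge0_ler_powR ?nnegrE// ltW.
apply: (@le_trans _ _ (r * ((b `^ (r - 1) - a `^ (r - 1)) * b))).
  rewrite [in leRHS]mulrBl powR_predM// mulrBr.
  have := powR_tangent r1 a0 b0; lra.
by rewrite ler_wpM2l ?ler_wpM2l// (le_trans _ (ltW r1)).
Qed.

(** Either [y <= e * x], and the first term dominates, or [x < y / e], and the
    second one does. *)
Lemma powR_absorb r e x y : 1 < r -> 0 < e -> 0 <= x -> 0 <= y ->
  x `^ (r - 1) * y <= e * x `^ r + (e^-1) `^ (r - 1) * y `^ r.
Proof.
move=> r1 e0 x0 y0; have r10 : 0 <= r - 1 by rewrite subr_ge0 ltW.
have [yx|xy] := leP y (e * x).
  apply: (@le_trans _ _ (e * x `^ r)); last by rewrite lerDl mulr_ge0 ?powR_ge0.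
  by rewrite -(powR_predM r1 x0) mulrCA ler_wpM2l ?powR_ge0.
apply: (@le_trans _ _ ((e^-1) `^ (r - 1) * y `^ r)); last first.
  by rewrite lerDr mulr_ge0 ?powR_ge0// ltW.
rewrite -(powR_predM r1 y0) mulrA -powRM ?invr_ge0//; last exact: ltW.
rewrite ler_wpM2r// ge0_ler_powR ?nnegrE ?mulr_ge0 ?invr_ge0//; first exact: ltW.
by rewrite -(ler_pM2l e0) mulrA divff ?gt_eqF// mul1r ltW.
Qed.

End powR_inequalities.

Section truncated_maximum.
Context {R : realType} {T : Type} (K : R) (s : nat -> T -> R).

(** The running maximum is capped at [K] so that all its moments are finite
    when they are subtracted from both sides of an inequality. *)
Fixpoint runmax (j : nat) (w : T) : R :=
  if j is i.+1 then Num.max (runmax i w) (Num.min K (s i w)) else 0.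

Lemma runmax_ge0 j w : 0 <= runmax j w.
Proof. by elim: j => //= j IH; rewrite le_max IH. Qed.

Lemma le_runmaxS j w : runmax j w <= runmax j.+1 w.
Proof. by rewrite /= le_max lexx. Qed.

Lemma runmax_le j w : 0 <= K -> runmax j w <= K.
Proof. by move=> K0; elim: j => //= j IH; rewrite ge_max IH ge_min lexx. Qed.

Lemma runmax_jump j w : runmax j w < runmax j.+1 w -> runmax j.+1 w <= s j w.
Proof. by rewrite /= lt_max ltxx/= => /ltW/max_idPr ->; rewrite ge_min lexx orbT. Qed.

Lemma min_le_runmax n j w : (j < n)%N -> Num.min K (s j w) <= runmax n w.
Proof.
elim: n => // n IH; rewrite ltnS leq_eqVlt => /predU1P[->|/IH h].
  by rewrite /= le_max lexx orbT.
exact: le_trans h (le_runmaxS _ _).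
Qed.

(** The increments of [runmax ^ (r - 1)] vanish except when the current sample
    is at least the running maximum, so the sum, in which the samples replace
    the maxima, still controls [runmax ^ r]. *)
Lemma runmax_powR r n w : 1 < r -> (r - 1) * runmax n w `^ r <=
  r * \sum_(j < n) (runmax j.+1 w `^ (r - 1) - runmax j w `^ (r - 1)) * s j w.
Proof.
move=> r1; elim: n => [|n IH].
  by rewrite big_ord0 /= powR0 ?mulr0// gt_eqF// (lt_trans _ r1).
rewrite big_ord_recr/= mulrDr.
have := powR_increment r1 (runmax_ge0 n w) (le_runmaxS n w) (@runmax_jump n w).
move: IH => /=; lra.
Qed.

End truncated_maximum.

(** * Doob's inequality in L^p *)

Lemma measurable_funX_powR {R : realType} d' (T : measurableType d') (D : set T)
    (f : T -> R) r : measurable_fun D f -> measurable_fun D (fun x => f x `^ r).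
Proof. by move=> mf; apply: (measurableT_comp (measurable_powR r)). Qed.

Section discrete_maximal_inequality.
Context {R : realType} {d : measure_display} {Omega : measurableType d}
  (P : probability Omega R).

(** [r * e = (r - 1) / 2] is half of the coefficient [r - 1] of the left-hand
    side of [runmax_powR], so the term in [e] produced by [powR_absorb] can be
    moved to the left. *)
Definition doob_const (r : R) : R :=
  let e := (r - 1) / (2 * r) in 2 / (r - 1) * (r * (e^-1) `^ (r - 1)).

Lemma doob_const_gt0 r : 1 < r -> 0 < doob_const r.
Proof.
move=> r1; have r0 : 0 < r by rewrite (lt_trans _ r1).
have r10 : 0 < r - 1 by rewrite subr_gt0.
by rewrite /doob_const !(mulr_gt0, divr_gt0, powR_gt0, invr_gt0).
Qed.

Variables (G : nat -> set (set Omega)) (s : nat -> Omega -> R) (v : Omega -> R).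
Hypothesis Gsig : forall j, sigma_algebra setT (G j).
Hypothesis Gm : forall j, G j `<=` measurable.
Hypothesis Gmono : forall j, G j `<=` G j.+1.
Hypothesis ms : forall j,
  measurable_fun setT (s j : g_sigma_algebraType (G j) -> R).
Hypothesis s0 : forall j w, 0 <= s j w.
Hypothesis mv : measurable_fun setT v.
Hypothesis v0 : forall w, 0 <= v w.
Hypothesis sv : forall j A, G j A ->
  (\int[P]_(w in A) (s j w)%:E <= \int[P]_(w in A) (v w)%:E)%E.

(** The weight in front of [s j] in [runmax_powR] involves the running maxima
    of index [j] and [j.+1], which are both known given [G j]. *)
Lemma measurable_runmax K j :
  measurable_fun setT (runmax K s j : g_sigma_algebraType (G j) -> R) /\
  measurable_fun setT (runmax K s j.+1 : g_sigma_algebraType (G j) -> R).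
Proof.
elim: j => [|j [_ IH]].
  split=> /=; first exact: measurable_cst.
  by apply: measurable_maxr => //; exact: measurable_minr.
have mS : measurable_fun setT
    (runmax K s j.+1 : g_sigma_algebraType (G j.+1) -> R).
  by move=> _ B mB; rewrite measurable_subE//; apply: Gmono;
    rewrite -measurable_subE//; exact: IH.
by split => //; apply: measurable_maxr => //; exact: measurable_minr.
Qed.

(** Integrate [runmax_powR], replace each sample [s j] by the terminal value [v]
    with [le_weighted_integral], and telescope: the integral of [runmax ^ r]
    is at most a multiple of that of [runmax ^ (r - 1) * v].  This product is
    split by [powR_absorb], and the part in [runmax ^ r], which is finite thanks
    to the cap [K], is absorbed. *)
Lemma doob_runmax (r K : R) n : 1 < r -> 0 <= K ->
  (\int[P]_w (runmax K s n w `^ r)%:E <=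
   (doob_const r)%:E * \int[P]_w (v w `^ r)%:E)%E.
Proof.
move=> r1 K0; have r0 : 0 < r by rewrite (lt_trans _ r1).
have r10 : 0 < r - 1 by rewrite subr_gt0.
set e := (r - 1) / (2 * r).
have e0 : 0 < e by rewrite divr_gt0// mulr_gt0.
pose a (j : nat) : Omega -> R := runmax K s j.
pose W (j : nat) (w : Omega) : R := r * (a j.+1 w `^ (r - 1) - a j w `^ (r - 1)).
have W0 j w : 0 <= W j w.
  rewrite mulr_ge0 ?(ltW r0)// subr_ge0 ge0_ler_powR ?nnegrE ?runmax_ge0 ?(ltW r10)//.
  exact: le_runmaxS.
have mW j : measurable_fun setT (W j : g_sigma_algebraType (G j) -> R).
  have [m1 m2] := measurable_runmax K j.
  apply: measurable_funM => //; apply: measurable_funB;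
  exact: measurable_funX_powR.
have mWO j : measurable_fun setT (W j : Omega -> R).
  by apply: (measurable_sub_fun (Gsig j) (@Gm j)); exact: mW j.
have msO j : measurable_fun setT (s j : Omega -> R).
  by apply: (measurable_sub_fun (Gsig j) (@Gm j)); exact: ms.
have ma j : measurable_fun setT (a j : Omega -> R).
  by apply: (measurable_sub_fun (Gsig j) (@Gm j)); exact: (measurable_runmax K j).1.
have mar q : measurable_fun setT (fun w => a n w `^ q) by exact: measurable_funX_powR.
have mvr q : measurable_fun setT (fun w => v w `^ q) by exact: measurable_funX_powR.
have Wsum w : \sum_(j < n) W j w = r * a n w `^ (r - 1).
  rewrite -mulr_sumr; congr (_ * _).
  rewrite -(big_mkord xpredT (fun j => a j.+1 w `^ (r - 1) - a j w `^ (r - 1))).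
  by rewrite telescope_sumr//= powR0 ?subr0// gt_eqF.
have ub : (\int[P]_w ((r - 1) * a n w `^ r)%:E <=
    \int[P]_w (r * (a n w `^ (r - 1) * v w))%:E)%E.
  apply: (@le_trans _ _ (\int[P]_w (\sum_(j < n) (W j w * s j w)%:E))%E).
    apply: le_nonneg_integral => w; rewrite ?lee_fin.
      by rewrite mulr_ge0 ?powR_ge0// ltW.
    rewrite sumEFin lee_fin; apply: (le_trans (runmax_powR _ _ _ _ r1)).
    by rewrite mulr_sumr; apply: ler_sum => j _; rewrite mulrA.
  rewrite ge0_integral_sum//; last 2 first.
  - by move=> j; apply/measurable_EFinP; exact: measurable_funM.
  - by move=> j w _; rewrite lee_fin mulr_ge0.
  apply: (@le_trans _ _ (\sum_(j < n) \int[P]_w (W j w * v w)%:E)%E).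
    apply: lee_sum => j _.
    exact: (le_weighted_integral (Gsig j) (@Gm j) (msO j) (s0 j) mv v0 (@sv j)).
  rewrite -ge0_integral_sum//; last 2 first.
  - by move=> j; apply/measurable_EFinP; exact: measurable_funM.
  - by move=> j w _; rewrite lee_fin mulr_ge0.
  apply: le_nonneg_integral => w.
    by apply: sume_ge0 => j _; rewrite lee_fin mulr_ge0.
  by rewrite sumEFin -mulr_suml Wsum mulrA.
have {}ub : ((r - 1)%:E * \int[P]_w (a n w `^ r)%:E <=
    ((r - 1) / 2)%:E * \int[P]_w (a n w `^ r)%:E +
    (r * (e^-1) `^ (r - 1))%:E * \int[P]_w (v w `^ r)%:E)%E.
  rewrite -!ge0_integralZl//; last 9 first.
  all: try (by rewrite lee_fin ?mulr_ge0 ?divr_ge0 ?powR_ge0// ltW).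
  all: try (by move=> w _; rewrite lee_fin powR_ge0).
  all: try (by apply/measurable_EFinP).
  rewrite -ge0_integralD//; last 4 first.
  all: try (by move=> w _; rewrite -EFinM lee_fin ?mulr_ge0 ?divr_ge0 ?powR_ge0// ltW).
  all: try (by apply/measurable_EFinP; exact: measurable_funM).
  apply: (le_trans ub); apply: le_nonneg_integral => w.
    by rewrite lee_fin mulr_ge0 ?mulr_ge0 ?powR_ge0// ltW.
  rewrite -!EFinM -EFinD lee_fin.
  have -> : (r - 1) / 2 = r * e by rewrite /e; field; rewrite gt_eqF.
  have -> : r * e * a n w `^ r + r * e^-1 `^ (r - 1) * v w `^ r =
    r * (e * a n w `^ r + e^-1 `^ (r - 1) * v w `^ r) by ring.
  rewrite ler_wpM2l ?(ltW r0)//.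
  by apply: powR_absorb => //; exact: runmax_ge0.
have afin : (\int[P]_w (a n w `^ r)%:E)%E \is a fin_num.
  rewrite ge0_fin_numE; last by apply: integral_ge0 => w _; rewrite lee_fin powR_ge0.
  apply: (@le_lt_trans _ _ (\int[P]_w (K `^ r)%:E)%E).
    apply: le_nonneg_integral => w; rewrite lee_fin ?powR_ge0//.
    by rewrite ge0_ler_powR ?nnegrE ?(ltW r0) ?runmax_ge0 ?runmax_le.
  by rewrite integral_cst//= probability_setT mule1 ltry.
have Y0 : (0 <= \int[P]_w (v w `^ r)%:E)%E.
  by apply: integral_ge0 => w _; rewrite lee_fin powR_ge0.
move: ub afin Y0; set X := (\int[P]_w (a n w `^ r)%:E)%E.
set Y := (\int[P]_w (v w `^ r)%:E)%E.
case: X => [x| |]//; case: Y => [y| |]// ub _ Y0; last first.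
  by rewrite gt0_muley ?leey// lte_fin doob_const_gt0.
move: ub; rewrite -!EFinM -EFinD !lee_fin => ub.
rewrite /doob_const -/e.
have -> : 2 / (r - 1) * (r * e^-1 `^ (r - 1)) * y =
    2 * (r * e^-1 `^ (r - 1) * y) / (r - 1) by field; rewrite gt_eqF.
rewrite ler_pdivlMr//; lra.
Qed.

End discrete_maximal_inequality.

Section liminf_bounds.
Context {R : realType}.
Implicit Types (u : (\bar R)^nat) (c : \bar R).

Lemma limn_einf_ge u c : (\forall k \near \oo, c <= u k)%E -> (c <= limn_einf u)%E.
Proof.
move=> [N _ cu]; rewrite limn_einf_lim; apply: lime_ge; first exact: is_cvg_einfs.
exists N => // k /= Nk; apply: le_ereal_inf_tmp => _ [l /= kl <-].
by apply: cu; exact: leq_trans kl.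
Qed.

Lemma limn_einf_le u c : (forall k, u k <= c)%E -> (limn_einf u <= c)%E.
Proof.
move=> uc; rewrite limn_einf_lim; apply: lime_le; first exact: is_cvg_einfs.
apply: nearW => k; apply: le_trans (uc k).
by apply: ereal_inf_lbound; exists k => /=.
Qed.

End liminf_bounds.

Section maximal_inequality.
Context {R : realType} {d : measure_display} {Omega : measurableType d}
  (P : probability Omega R).

(** On the set of [G] where [s] exceeds the bound [M] of [v], the comparison of
    the integrals forces the integral of [s - M] to vanish. *)
Lemma ae_le_cst (G : set (set Omega)) (s v : Omega -> R) M :
  sigma_algebra setT G -> G `<=` measurable ->
  measurable_fun setT (s : g_sigma_algebraType G -> R) ->
  (forall w, 0 <= s w) -> measurable_fun setT v -> (forall w, 0 <= v w) ->
  (forall A, G A -> \int[P]_(w in A) (s w)%:E <= \int[P]_(w in A) (v w)%:E)%E ->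
  {ae P, forall w, v w <= M} -> 0 <= M -> {ae P, forall w, s w <= M}.
Proof.
move=> Gsig Gm ms s0 mv v0 sv vM M0.
have msO : measurable_fun setT (s : Omega -> R) by exact: measurable_sub_fun ms.
pose B : set Omega := s @^-1` `]M, +oo[.
have GB : G B.
  by rewrite -measurable_subE// -[B]setTI; apply: ms => //; exact: measurable_itv.
have mB : measurable B by exact: Gm.
have Bs w : B w -> M < s w by rewrite /B/= in_itv/= andbT.
have mBf (f : Omega -> R) : measurable_fun setT f ->
    measurable_fun B (fun w => (f w)%:E).
  by move=> mf; apply/measurable_EFinP; exact: measurable_funTS.
have : (\int[P]_(w in B) (s w)%:E <= M%:E * P B)%E.
  rewrite -integral_cst//; apply: (le_trans (sv _ GB)).
  apply: ae_ge0_le_integral => //.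
  - by move=> w _; rewrite lee_fin.
  - exact: mBf.
  - by apply: filterS vM => w + _; rewrite lee_fin.
have -> : (\int[P]_(w in B) (s w)%:E =
    M%:E * P B + \int[P]_(w in B) (s w - M)%:E)%E.
  rewrite -integral_cst// -ge0_integralD//.
  - by apply: eq_integral => w _; rewrite -EFinD subrKC.
  - by move=> w Bw; rewrite lee_fin subr_ge0 ltW// Bs.
  - by apply: mBf; exact: measurable_funB.
have PB : (M%:E * P B)%E \is a fin_num.
  by rewrite fin_numM// fin_num_measure.
rewrite -[leRHS]adde0 leeD2lE// => I0.
have /ae_eq_integral_abs : (\int[P]_(w in B) `|(s w - M)%:E| = 0)%E.
  apply/eqP; rewrite eq_le; apply/andP; split; last exact: integral_ge0.
  rewrite (le_trans _ I0)// le_eqVlt; apply/orP; left; apply/eqP.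
  apply: eq_integral => w /set_mem Bw.
  by rewrite gee0_abs// lee_fin subr_ge0 ltW// Bs.
move=> /(_ mB) h; apply: filterS (h _) => [w Bw|].
  rewrite leNgt; apply/negP => Ms.
  have := Bw; rewrite /B/= in_itv/= andbT => /(_ Ms) [] /eqP.
  by rewrite subr_eq0 gt_eqF.
by apply: mBf; exact: measurable_funB.
Qed.

Variables (G : nat -> nat -> set (set Omega)) (s : nat -> nat -> Omega -> R).
Variables (N : nat -> nat) (v : Omega -> R) (p : \bar R) (S : Omega -> \bar R).
Hypothesis p1 : (1 < p)%E.
Hypothesis Gsig : forall k j, sigma_algebra setT (G k j).
Hypothesis Gm : forall k j, G k j `<=` measurable.
Hypothesis Gmono : forall k j, G k j `<=` G k j.+1.
Hypothesis ms : forall k j,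
  measurable_fun setT (s k j : g_sigma_algebraType (G k j) -> R).
Hypothesis s0 : forall k j w, 0 <= s k j w.
Hypothesis v0 : forall w, 0 <= v w.
Hypothesis vp : v \in Lfun P p.
Hypothesis sv : forall k j A, G k j A ->
  (\int[P]_(w in A) (s k j w)%:E <= \int[P]_(w in A) (v w)%:E)%E.
Hypothesis S0 : forall w, (0 <= S w)%E.
Hypothesis Ss : forall w (c : R), (c%:E < S w)%E ->
  \forall k \near \oo, exists2 j, (j < N k)%N & c < s k j w.

(** Doob's inequality for a function [S] that is reached by the maxima of
    finite families of samples, the [k]-th family being
    [s k 0, ..., s k (N k - 1)].  For finite [p], [doob_runmax] with cap [k]
    bounds the truncated maxima uniformly in [k], and Fatou's lemma passes to
    [S].  For infinite [p], all the samples are almost surely below the bound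
    of [v]. *)
Lemma limsup_maximal_Lnorm : ('N[P]_p[S] < +oo)%E.
Proof.
have mv : measurable_fun setT v by move: vp; rewrite inE => /andP[]; rewrite inE.
have fv : ('N[P]_p[EFin \o v] < +oo)%E.
  by move: vp; rewrite inE => /andP[_]; rewrite inE.
case: p p1 fv => [r||//]; last first.
  move=> _; rewrite unlock /= probability_setT lte01 => /ess_supr_bounded[M' vM'].
  pose M := Num.max M' 0.
  have M0 : 0 <= M by rewrite le_max lexx orbT.
  have vM : {ae P, forall w, v w <= M}.
    by apply: filterS vM' => w; rewrite /= ger0_norm// /M le_max => ->.
  have sM : {ae P, forall w, forall k j, s k j w <= M}.
    apply: ae_foralln => k; apply: ae_foralln => j.
    exact: (ae_le_cst (@Gsig k j) (@Gm k j) (@ms k j) (@s0 k j) mv v0 (@sv k j)).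
  apply: (@le_lt_trans _ _ M%:E); last exact: ltry.
  apply/ess_supP; apply: filterS sM => w sM /=; rewrite gee0_abs// leNgt.
  apply/negP => /Ss[k _ /(_ k (leqnn k))[j _]].
  by rewrite ltNge sM.
rewrite lte_fin => r1; have r0 : 0 < r by rewrite (lt_trans _ r1).
move=> fv; rewrite unlock; apply: poweR_lty.
pose u k w := (runmax k%:R (s k) (N k) w `^ r)%:E.
have Su w : (S w `^ r <= limn_einf (u^~ w))%E.
  rewrite leNgt; apply/negP => LS.
  have L0 : (0 <= limn_einf (u^~ w))%E.
    by apply: limn_einf_ge; apply: nearW => k; rewrite lee_fin powR_ge0.
  move: L0 LS; case L : (limn_einf (u^~ w)) => [l| |]//; last first.
    by move=> _; rewrite ltNge leey.
  rewrite lee_fin => l0 lS; pose c := l `^ r^-1.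
  have cr : c `^ r = l by rewrite -powRrM mulVf ?gt_eqF// powRr1.
  have [b cb bS] : exists2 b, c < b & (b%:E < S w)%E.
    have := S0 w; case E : (S w) => [x| |]//; rewrite ?lee_fin => x0; last first.
      by exists (c + 1); rewrite ?ltrDl// ltry.
    have cx : c < x.
      rewrite ltNge; apply/negP => xc; move: lS.
      rewrite E poweR_EFin lte_fin -cr ltNge ge0_ler_powR ?nnegrE ?(ltW r0)//.
      exact: powR_ge0.
    by exists ((c + x) / 2); rewrite ?lte_fin; lra.
  have b0 : 0 <= b by rewrite (le_trans _ (ltW cb))// powR_ge0.
  have : ((b `^ r)%:E <= l%:E)%E.
    rewrite -L; apply: limn_einf_ge.
    near=> k; rewrite lee_fin ge0_ler_powR ?nnegrE ?(ltW r0) ?runmax_ge0//.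
    have [j jN bs] : exists2 j, (j < N k)%N & b < s k j w.
      by near: k; exact: Ss.
    apply: le_trans (min_le_runmax k%:R (s k) w jN).
    rewrite le_min (ltW bs) andbT.
    near: k; exact: nbhs_infty_ger.
  rewrite lee_fin -cr leNgt => /negP; apply.
  by rewrite gt0_ltr_powR ?nnegrE// powR_ge0.
apply: (@le_lt_trans _ _ (\int[P]_w limn_einf (u^~ w))%E).
  apply: le_nonneg_integral => w; first exact: poweR_ge0.
  by rewrite gee0_abs.
have mu k : measurable_fun setT (u k).
  apply/measurable_EFinP; apply: measurable_funX_powR.
  apply: (measurable_sub_fun (@Gsig k (N k)) (@Gm k (N k))).
  by have [] := measurable_runmax (@Gsig k) (@Gmono k) (@ms k) k%:R (N k).
apply: (@le_lt_trans _ _ ((doob_const r)%:E * \int[P]_w (v w `^ r)%:E)%E).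
  apply: (le_trans (fatou P measurableT mu _)).
    by move=> k w _; rewrite lee_fin powR_ge0.
  apply: limn_einf_le => k.
  exact: (doob_runmax (@Gsig k) (@Gm k) (@Gmono k) (@ms k) (@s0 k) mv v0 (@sv k)).
rewrite lte_mul_pinfty// ?lee_fin ?(ltW (doob_const_gt0 r1))//.
have -> : (\int[P]_w (v w `^ r)%:E = \int[P]_w `|(EFin \o v) w| `^ r)%E.
  by apply: eq_integral => w _; rewrite /= ger0_norm.
by rewrite -poweR_Lnorm ?gt_eqF//; exact: poweR_lty.
Unshelve. all: by end_near. Qed.

End maximal_inequality.

(** * Conditional expectations *)

Section restricted_charge.
Context {R : realType} {d : measure_display} {Omega : measurableType d}
  (P : probability Omega R) (G : set (set Omega)).
Hypothesis Gsig : sigma_algebra setT G.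
Hypothesis Gm : G `<=` measurable.
Variable f : Omega -> \bar R.
Hypothesis intf : P.-integrable setT f.

Local Notation GT := (g_sigma_algebraType G).

Definition restricted_charge (A : set GT) : \bar R := (\int[P]_(w in A) f w)%E.

Let mG (A : set GT) : measurable A -> measurable (A : set Omega).
Proof. by move=> mA; apply: Gm; rewrite -measurable_subE. Qed.

Let nu : {charge set Omega -> \bar R} := induced_charge intf.

Let restricted0 : restricted_charge set0 = 0%E.
Proof. exact: (charge0 nu). Qed.

Let restricted_fin A : measurable A -> restricted_charge A \is a fin_num.
Proof. by move=> /mG; exact: (fin_num_measure nu). Qed.

Let restricted_sigma_additive : semi_sigma_additive restricted_charge.
Proof.
move=> F mF tF mUF.
exact (@charge_semi_sigma_additive _ _ _ nu F (fun k => mG (mF k)) tF (mG mUF)).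
Qed.

HB.instance Definition _ := isCharge.Build _ _ _ restricted_charge
  restricted0 restricted_fin restricted_sigma_additive.

(** The conditional expectation is the Radon-Nikodym derivative, on [GT], of the
    charge with density [f] with respect to the restriction of [P] to [G]. *)
Lemma condexp_scalar_exists : exists z : GT -> R,
  [/\ measurable_fun setT z, P.-integrable setT (EFin \o z) &
      forall A, G A -> (\int[P]_(w in A) (z w)%:E = \int[P]_(w in A) f w)%E].
Proof.
have mid : measurable_fun setT (idfun : Omega -> GT).
  by move=> _ B /mG mB; rewrite setTI.
pose idm := isMeasurableFun.Build _ _ _ _ _ mid.
pose idG : {mfun Omega >-> GT} := HB.pack (idfun : Omega -> GT) idm.
pose mu : probability GT R := distribution P idG.
pose nuG : {charge set GT -> \bar R} := restricted_charge.
have numu : nuG `<< mu.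
  apply/null_content_dominatesP => A mA muA.
  apply: null_set_integral => //; first exact: mG.
  by apply: measurable_funTS; exact: measurable_int intf.
pose g := Radon_Nikodym nuG mu.
have gfin w : g w \is a fin_num by exact: Radon_Nikodym_fin_num.
have gint : mu.-integrable setT g by exact: Radon_Nikodym_integrable.
have mg : measurable_fun setT g by exact: measurable_int gint.
have gE : EFin \o (fine \o g) = g by apply/funext => w /=; rewrite fineK.
have mgO : measurable_fun setT (g : Omega -> \bar R).
  by move=> _ B mB; apply: mG; exact: mg.
have intg : P.-integrable setT (g : Omega -> \bar R).
  apply/integrableP; split => //.
  move/integrableP : gint => [_]; rewrite (ge0_integral_distribution idG)//.
  exact: measurableT_comp.
exists (fine \o g); split.
- by apply/measurable_EFinP; rewrite gE.
- by rewrite gE.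
move=> A GA; have mA : measurable (A : set GT) by rewrite measurable_subE.
rewrite -[RHS]/(nuG A) (Radon_Nikodym_integral numu mA).
rewrite -/g (integral_pushforward mid)//.
  by apply: eq_integral => w _ /=; rewrite fineK.
by apply: integrableS intg => //; exact: mG.
Qed.

End restricted_charge.

Definition complete_sub_sigma_algebra {R : realType} {d : measure_display}
    {Omega : measurableType d} (P : probability Omega R) (G : set (set Omega)) :=
  [/\ sigma_algebra setT G, G `<=` measurable & P.-negligible `<=` G].

Definition integrable_rV {R : realType} {d : measure_display}
    {Omega : measurableType d} (P : probability Omega R) {n : nat}
    (X : Omega -> 'rV[R]_n) :=
  forall i : 'I_n, P.-integrable setT (fun w => (X w ord0 i)%:E).

(** Preimages under [X] and [Y] differ by subsets of the negligible set where
    [X] and [Y] differ, and these subsets all belong to [G].  Thus measurability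
    does not depend on the representative of a class. *)
Lemma sub_measurable_ae {R : realType} {d : measure_display}
    {Omega : measurableType d} {P : probability Omega R} {n : nat}
    {G : set (set Omega)} (X Y : Omega -> 'rV[R]_n) :
  sigma_algebra setT G -> P.-negligible `<=` G ->
  {ae P, forall w, X w = Y w} -> sub_measurable G X -> sub_measurable G Y.
Proof.
move=> Gsig Gneg XY /(sub_measurableP Gsig) mX.
apply/(sub_measurableP Gsig) => i _ B mB.
rewrite setTI measurable_subE//.
pose N := [set w | X w <> Y w]; have negN : P.-negligible N := XY.
have -> : (fun w => Y w ord0 i) @^-1` B =
    ((fun w => X w ord0 i) @^-1` B `\` N) `|`
    (N `&` (fun w => Y w ord0 i) @^-1` B).
  apply/seteqP; split => w /=; last by move=> [[XB /contrapT <-]|[]].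
  move=> YB; have [Nw|/contrapT E] := pselect (N w); [by right|left].
  by rewrite E; split => // /(_ E).
apply: sub_setU => //.
  apply: sub_setD => //; last exact: Gneg.
  by rewrite -measurable_subE// -[X in measurable X]setTI; exact: mX.
by apply: Gneg; exact: negligibleS (@subIsetl _ _ _) negN.
Qed.

Section conditional_expectation.
Context {R : realType} {d : measure_display} {Omega : measurableType d}
  {P : probability Omega R} {n : nat} {G : set (set Omega)}.
Hypothesis GS : complete_sub_sigma_algebra P G.
Implicit Types V X Y : Omega -> 'rV[R]_n.

Let Gsig : sigma_algebra setT G. Proof. by case: GS. Qed.
Let Gm : G `<=` measurable. Proof. by case: GS. Qed.
Let Gneg : P.-negligible `<=` G. Proof. by case: GS. Qed.

Lemma integrable_rV_measurable X : integrable_rV P X ->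
  forall i, measurable_fun setT (fun w => X w ord0 i).
Proof. by move=> iX i; apply/measurable_EFinP; exact: measurable_int (iX i). Qed.

Lemma integrable_rVB X Y : integrable_rV P X -> integrable_rV P Y ->
  integrable_rV P (fun w => X w - Y w).
Proof.
move=> iX iY i; have := integrableB measurableT (iX i) (iY i).
by apply: eq_integrable => // w _; rewrite !mxE.
Qed.

Lemma measurable_ae X Y : {ae P, forall w, X w = Y w} ->
  (forall i, measurable_fun setT (fun w => X w ord0 i)) ->
  forall i, measurable_fun setT (fun w => Y w ord0 i).
Proof.
move=> XY mX i; apply: (sub_measurable_fun i (@subset_refl _ measurable)).
apply: (sub_measurable_ae _ _ XY).
- exact: sigma_algebra_measurable.
- exact: subset_trans Gneg Gm.
- by move=> j _ [B mB <-]; exact: mX.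
Qed.

Lemma integrable_rV_ae X Y : {ae P, forall w, X w = Y w} ->
  integrable_rV P X -> integrable_rV P Y.
Proof.
move=> XY iX i; have mX := integrable_rV_measurable iX.
have mY := measurable_ae XY mX.
move/integrableP : (iX i) => [_ fX]; apply/integrableP; split.
  exact/measurable_EFinP.
apply: le_lt_trans fX; rewrite le_eqVlt; apply/orP; left; apply/eqP.
apply: ae_eq_integral => //.
- by apply: measurableT_comp => //; exact/measurable_EFinP.
- by apply: measurableT_comp => //; exact/measurable_EFinP.
- by apply: filterS XY => w /= -> _.
Qed.

Lemma is_condexp_ae V V' X X' : integrable_rV P V ->
  {ae P, forall w, V w = V' w} -> {ae P, forall w, X w = X' w} ->
  is_condexp P G V X -> is_condexp P G V' X'.
Proof.
move=> iV VV' XX' [GX iX EX].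
have iX' := integrable_rV_ae XX' iX; have iV' := integrable_rV_ae VV' iV.
have E (Y Y' : Omega -> 'rV[R]_n) i A : integrable_rV P Y -> integrable_rV P Y' ->
    {ae P, forall w, Y w = Y' w} -> G A ->
    (\int[P]_(w in A) (Y w ord0 i)%:E = \int[P]_(w in A) (Y' w ord0 i)%:E)%E.
  move=> iY iY' YY' GA; apply: ae_eq_integral.
  - exact: Gm.
  - by apply: measurable_funTS; exact: measurable_int (iY i).
  - by apply: measurable_funTS; exact: measurable_int (iY' i).
  - by apply: filterS YY' => w -> _.
split => //; first exact: (sub_measurable_ae Gsig Gneg XX' GX).
by move=> i A GA; rewrite -(E X X')// EX// (E V V').
Qed.

Lemma is_condexp_id X : sub_measurable G X -> integrable_rV P X ->
  is_condexp P G X X.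
Proof. by split. Qed.

Lemma sub_measurableB X Y : sub_measurable G X -> sub_measurable G Y ->
  sub_measurable G (fun w => X w - Y w).
Proof.
move=> /(sub_measurableP Gsig) mX /(sub_measurableP Gsig) mY.
apply/(sub_measurableP Gsig) => i.
under [X in measurable_fun _ X]eq_fun do rewrite !mxE.
exact: measurable_funB.
Qed.

Lemma sub_measurableD X Y : sub_measurable G X -> sub_measurable G Y ->
  sub_measurable G (fun w => X w + Y w).
Proof.
move=> /(sub_measurableP Gsig) mX /(sub_measurableP Gsig) mY.
apply/(sub_measurableP Gsig) => i.
under [X in measurable_fun _ X]eq_fun do rewrite !mxE.
exact: measurable_funD.
Qed.

Lemma is_condexpB V V' X X' : integrable_rV P V -> integrable_rV P V' ->
  is_condexp P G V X -> is_condexp P G V' X' ->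
  is_condexp P G (fun w => V w - V' w) (fun w => X w - X' w).
Proof.
move=> iV iV' [GX iX EX] [GX' iX' EX']; split.
- exact: sub_measurableB.
- exact: integrable_rVB.
move=> i A GA; have mA := Gm GA.
under eq_integral do rewrite !mxE EFinD EFinN.
under [in RHS]eq_integral do rewrite !mxE EFinD EFinN.
have iA Y i' : integrable_rV P Y -> P.-integrable A (EFin \o (fun w => Y w ord0 i')).
  by move=> iY; apply: integrableS (iY i').
by rewrite !integralB_EFin//; do ?exact: iA; rewrite EX// EX'.
Qed.

Lemma condexp_exists V : integrable_rV P V -> exists X, is_condexp P G V X.
Proof.
move=> iV.
have /choice[z zP] (i : 'I_n) := condexp_scalar_exists Gsig Gm (iV i).
exists (fun w => \row_i z i w); split.
- apply/(sub_measurableP Gsig) => i.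
  by under [X in measurable_fun _ X]eq_fun do rewrite mxE; have [] := zP i.
- move=> i; have [_ + _] := zP i.
  by apply: eq_integrable => // w _; rewrite mxE.
- move=> i A GA; have [_ _ <-//] := zP i.
  by apply: eq_integral => w _; rewrite mxE.
Qed.

(** In each coordinate, split [A] according to the sign of [X]: on either part
    the integral of the absolute value is the absolute value of the integral,
    and the latter is the same for [X] and [V]. *)
Lemma condexp_l1_contract V X A : integrable_rV P V -> is_condexp P G V X ->
  G A -> (\int[P]_(w in A) (l1norm (X w))%:E <= \int[P]_(w in A) (l1norm (V w))%:E)%E.
Proof.
move=> iV [/(sub_measurableP Gsig) GX iX EX] GA; have mA := Gm GA.
have mX i := integrable_rV_measurable iX i.
have mV i := integrable_rV_measurable iV i.
have mN (Y : Omega -> 'rV[R]_n) i (B : set Omega) :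
    measurable_fun setT (fun w => Y w ord0 i) ->
    measurable_fun B (fun w => `|Y w ord0 i|%:E).
  by move=> mY; apply/measurable_EFinP; apply: measurable_funTS; exact: measurableT_comp.
under eq_integral do rewrite -sumEFin.
under [leRHS]eq_integral do rewrite -sumEFin.
rewrite !ge0_integral_sum//; [|by move=> i; exact: mN..].
apply: lee_sum => i _.
have absE (B : set Omega) : G B -> (forall w, B w -> 0 <= X w ord0 i) \/
    (forall w, B w -> X w ord0 i <= 0) ->
    (\int[P]_(w in B) `|X w ord0 i|%:E <= \int[P]_(w in B) `|V w ord0 i|%:E)%E.
  move=> GB sX; have mB := Gm GB.
  have -> : (\int[P]_(w in B) `|X w ord0 i|%:E =
      `|\int[P]_(w in B) (X w ord0 i)%:E|)%E.
    case: sX => sX.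
      rewrite gee0_abs; last by apply: integral_ge0 => w Bw; rewrite lee_fin sX.
      by apply: eq_integral => w /set_mem Bw; rewrite ger0_norm// sX.
    have -> : (\int[P]_(w in B) (X w ord0 i)%:E =
        - \int[P]_(w in B) `|X w ord0 i|%:E)%E.
      rewrite -integral_ge0N//; apply: eq_integral => w /set_mem Bw.
      by rewrite -EFinN ler0_norm ?opprK// sX.
    by rewrite abseN gee0_abs//; apply: integral_ge0.
  rewrite EX//; apply: (le_trans (le_abse_integral _ _ _)) => //.
  by apply/measurable_EFinP; exact: measurable_funTS.
pose C : set Omega := (fun w => X w ord0 i) @^-1` `[0, +oo[.
have GC : G C.
  by rewrite -measurable_subE// -[C]setTI; apply: GX => //; exact: measurable_itv.
have GI : G (A `&` C) by exact: sub_setI.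
have GD : G (A `\` C) by exact: sub_setD.
have AE : A = (A `&` C) `|` (A `\` C) by rewrite setDE -setIUr setUv setIT.
have dis : [disjoint A `&` C & A `\` C].
  by apply/disj_setPS => w [[_ Cw] [_ /(_ Cw)]].
rewrite AE !ge0_integral_setU//; try exact: Gm; try exact: mN.
apply: leeD; apply: absE => //; [left|right] => w [_].
  by rewrite /C/= in_itv/= andbT.
by rewrite /C/= in_itv/= andbT => /negP; rewrite -ltNge => /ltW.
Qed.

Lemma l1norm_ae_eq0 X : (forall i, measurable_fun setT (fun w => X w ord0 i)) ->
  (\int[P]_w (l1norm (X w))%:E <= 0)%E -> {ae P, forall w, X w = 0}.
Proof.
move=> mX I0.
have /ae_eq_integral_abs h : (\int[P]_w `|(l1norm (X w))%:E| = 0)%E.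
  apply/eqP; rewrite eq_le; apply/andP; split; last exact: integral_ge0.
  apply: le_trans I0; rewrite le_eqVlt; apply/orP; left; apply/eqP.
  by apply: eq_integral => w _; rewrite gee0_abs// lee_fin l1norm_ge0.
have : ae_eq P setT (fun w => (l1norm (X w))%:E) (cst 0%E).
  by apply: h => //; apply/measurable_EFinP; exact: measurable_l1norm.
by apply: filterS => w /(_ I) [] /l1norm0_eq0.
Qed.

(** The difference of two versions is a conditional expectation of 0, hence
    vanishes by the contraction property. *)
Lemma condexp_unique V X X' : integrable_rV P V ->
  is_condexp P G V X -> is_condexp P G V X' -> {ae P, forall w, X w = X' w}.
Proof.
move=> iV VX VX'; have VV := is_condexpB iV iV VX VX'.
have GT : G setT by rewrite -measurable_subE//; exact: measurableT.
have mB : forall i, measurable_fun setT (fun w => (X w - X' w) ord0 i).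
  by case: VV => _ + _; exact: integrable_rV_measurable.
have : {ae P, forall w, X w - X' w = 0}.
  apply: l1norm_ae_eq0 => //.
  apply: (le_trans (condexp_l1_contract (integrable_rVB iV iV) VV GT)).
  rewrite (eq_integral (cst 0%E)) ?integral0// => w _.
  by rewrite subrr /l1norm big1// => i _; rewrite mxE normr0.
by apply: filterS => w /eqP; rewrite subr_eq0 => /eqP.
Qed.

Lemma rvec_class_ae (X : Omega -> 'rV[R]_n) (V : rvec P n) :
  rvec_class P X = V -> {ae P, forall w, X w = V w}.
Proof. by move=> XV; apply/rvec_classP; rewrite rvec_classK. Qed.

Lemma condexpP (V : rvec P n) : integrable_rV P V ->
  is_condexp P G V (condexp G V).
Proof.
move=> iV; have [X VX] := condexp_exists iV.
have [X' VX' /rvec_class_ae E] : (rvec_class P @` is_condexp P G V) (condexp G V).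
  by apply: xgetPex; exists (rvec_class P X); exists X.
exact: is_condexp_ae iV (aeW _ (fun=> erefl)) E VX'.
Qed.

Lemma condexp_ae (V : rvec P n) X : integrable_rV P V -> is_condexp P G V X ->
  {ae P, forall w, condexp G V w = X w}.
Proof. by move=> iV; apply: condexp_unique => //; exact: condexpP. Qed.

End conditional_expectation.

(** * Processes with right-continuous paths *)

Section right_continuous_paths.
Context {R : realType}.

Lemma l1norm_continuous n : continuous (@l1norm R n).
Proof.
rewrite /l1norm; apply: continuous_big => [|i _].
  exact: add_continuous.
move=> x; apply: (@continuous_comp _ _ _ (fun y : 'rV[R]_n => y ord0 i)).
  exact: coord_continuous.
exact: norm_continuous.
Qed.

(** The [k]-th grid divides [[0, T]] into [k + 1] equal steps; the cap at [T]
    makes every index a time of the interval. *)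
Definition grid (T : R) (k j : nat) : R := Num.min T (j%:R * (T / k.+1%:R)).

Variable T : R.
Hypothesis T0 : 0 <= T.

Lemma grid_itv k j : 0 <= grid T k j <= T.
Proof. by rewrite /grid le_min T0 mulr_ge0 ?divr_ge0//= ge_min lexx. Qed.

Lemma le_grid k j : grid T k j <= grid T k j.+1.
Proof.
rewrite /grid le_min ge_min lexx/= ge_min ler_wpM2r ?orbT ?divr_ge0//.
by rewrite ler_nat.
Qed.

(** By right continuity the inequality at [t] persists on some interval to the
    right of [t], which contains the first point of every fine enough grid
    after [t].  The final time [T] is itself a point of each grid. *)
Lemma rcll_grid n (x : R -> 'rV[R]_n) (t c : R) : rcll T x -> 0 <= t <= T ->
  c < l1norm (x t) ->
  \forall k \near \oo, exists2 j, (j < k.+2)%N & c < l1norm (x (grid T k j)).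
Proof.
move=> [rcx _] /andP[t0]; rewrite le_eqVlt => /predU1P[-> cT|tT ct].
  apply: nearW => k; exists k.+1 => //.
  by rewrite /grid mulrC divfK ?pnatr_eq0// minxx.
have T1 : 0 < T by rewrite (le_lt_trans t0).
have xt : l1norm (x s) @[s --> t^'+] --> l1norm (x t).
  apply: (cvg_comp _ _ (rcx t _)); first by rewrite t0.
  exact: l1norm_continuous.
have [e /= e0 eP] : \forall s \near t^'+, c < l1norm (x s).
  exact: (cvgr_gt _ xt).
near=> k.
have ke : T / k.+1%:R < e.
  rewrite ltr_pdivrMr ?ltr0n// -ltr_pdivrMl// mulrC.
  apply: (@lt_trans _ _ k%:R); last by rewrite ltr_nat.
  by near: k; exact: nbhs_infty_gtr.
have y0 : 0 <= t * k.+1%:R / T by rewrite divr_ge0 ?mulr_ge0.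
pose j := (Num.truncn (t * k.+1%:R / T)).+1.
have /andP[j1 j2] := truncn_itv y0.
have jE : j%:R * (T / k.+1%:R) =
    (Num.truncn (t * k.+1%:R / T))%:R * (T / k.+1%:R) + T / k.+1%:R.
  by rewrite /j -natr1 mulrDl mul1r.
have h1 : t < j%:R * (T / k.+1%:R).
  by rewrite mulrA ltr_pdivlMr ?ltr0n// -ltr_pdivrMr.
have h2 : j%:R * (T / k.+1%:R) < t + e.
  rewrite jE ler_ltD//.
  by rewrite mulrA ler_pdivrMr ?ltr0n// -ler_pdivlMr.
exists j.
  rewrite ltnS -(ltr_nat R) (le_lt_trans j1)// ltr_pdivrMr// mulrC.
  by rewrite ltr_pM2l ?ltr0n.
apply: eP; last by rewrite /grid lt_min tT h1.
rewrite /= ltr0_norm; last by rewrite subr_lt0 /grid lt_min tT h1.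
by rewrite opprB ltrBlDl /grid gt_min h2 orbT.
Unshelve. all: by end_near. Qed.

End right_continuous_paths.

Section processes_with_rcll_paths.
Context {R : realType} {d : measure_display} {Omega : measurableType d}
  {P : probability Omega R} {n : nat} {T : R} {FF : R -> set (set Omega)}.
Hypothesis T0 : 0 <= T.
Hypothesis hFF : usual_filtration P T FF.
Implicit Types X Y : R -> Omega -> 'rV[R]_n.

Lemma filtration_complete t : 0 <= t <= T -> complete_sub_sigma_algebra P (FF t).
Proof.
move=> /andP[t0 tT]; split.
- by apply: (filtration_sigma_algebra hFF); rewrite t0.
- by apply: (filtration_measurable hFF); rewrite t0.
- move=> N /(usual_complete hFF); exact: (filtration_mono hFF).
Qed.

(** Almost surely the two processes agree on all the grids, which are countably
    many times, and right continuity extends the equality to [[0, T]]. *)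
Lemma rcll_modification_indist X Y :
  (forall w, rcll T (X^~ w)) -> (forall w, rcll T (Y^~ w)) ->
  (forall t, 0 <= t <= T -> {ae P, forall w, X t w = Y t w}) ->
  {ae P, forall w t, 0 <= t <= T -> X t w = Y t w}.
Proof.
move=> rX rY XY.
have : {ae P, forall w, forall k j, X (grid T k j) w = Y (grid T k j) w}.
  by apply: ae_foralln => k; apply: ae_foralln => j; apply: XY; exact: grid_itv.
apply: filterS => w XYg t tT; apply/eqP; rewrite -subr_eq0; apply/eqP.
apply: l1norm0_eq0; apply/eqP; rewrite eq_le l1norm_ge0 andbT leNgt.
apply/negP => h.
have rXY : rcll T (fun t => X t w - Y t w).
  split=> [u uT|u uT].
    by apply: cvgB; [exact: (rX w).1|exact: (rY w).1].
  by apply: is_cvgB; [exact: (rX w).2|exact: (rY w).2].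
have [k _ /(_ k (leqnn k))[j _]] := rcll_grid T0 rXY tT h.
by rewrite XYg subrr /l1norm big1 ?ltxx// => i _; rewrite mxE normr0.
Qed.

(** Doob's inequality in continuous time: the samples are the values of the
    process on the grids, and [rcll_grid] says that their maxima reach the
    supremum over [[0, T]]. *)
Lemma rcll_dominated_sup (p : \bar R) X (v : Omega -> R) : (1 < p)%E ->
  (forall w, rcll T (X^~ w)) -> adapted T FF X ->
  v \in Lfun P p -> (forall w, 0 <= v w) ->
  (forall t A, 0 <= t <= T -> FF t A ->
    (\int[P]_(w in A) (l1norm (X t w))%:E <= \int[P]_(w in A) (v w)%:E)%E) ->
  ('N[P]_p[sup_enorm T X] < +oo)%E.
Proof.
move=> p1 rX aX vp v0 Xv.
apply: (@limsup_maximal_Lnorm _ _ _ P (fun k j => FF (grid T k j))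
  (fun k j w => l1norm (X (grid T k j) w)) (fun k => k.+2) v) => //.
- by move=> k j; apply: (filtration_sigma_algebra hFF); exact: grid_itv.
- by move=> k j; apply: (filtration_measurable hFF); exact: grid_itv.
- move=> k j; have /andP[g0 _] := grid_itv T0 k j.
  have /andP[_ gT] := grid_itv T0 k j.+1.
  exact: (filtration_mono hFF) g0 (le_grid T0 k j) gT.
- move=> k j; apply: measurable_l1norm.
  apply/sub_measurableP; last by apply: aX; exact: grid_itv.
  by apply: (filtration_sigma_algebra hFF); exact: grid_itv.
- by move=> k j w; exact: l1norm_ge0.
- by move=> k j A; apply: Xv; exact: grid_itv.
- move=> w; apply: (@le_trans _ _ (enorm (X 0 w))%:E).
    by rewrite lee_fin enorm_ge0.
  by apply: ereal_sup_ubound; exists 0 => //=; rewrite lexx.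
- move=> w c /ereal_sup_gt[_ [t tT <-]]; rewrite lte_fin => cX.
  apply: (rcll_grid T0 (rX w) tT).
  exact: lt_le_trans cX (enorm_le_l1norm _).
Qed.

End processes_with_rcll_paths.

(** * The spaces of the problem *)

Lemma ae_and {R : realType} {d : measure_display} {Omega : measurableType d}
    {P : probability Omega R} (A B : Omega -> Prop) :
  {ae P, forall w, A w} -> {ae P, forall w, B w} -> {ae P, forall w, A w /\ B w}.
Proof. exact: filterI. Qed.

Section Lp_spaces.
Context {R : realType} {d : measure_display} {Omega : measurableType d}
  {P : probability Omega R} {n : nat} {p : \bar R}.
Hypothesis p1 : (1 < p)%E.
Implicit Types (X Y : Omega -> 'rV[R]_n) (u v : Omega -> R).

Let p1' : (1 <= p)%E. Proof. exact: ltW. Qed.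
Let p0 : (0 <= p)%E. Proof. by apply: le_trans p1'. Qed.

Lemma Lfun_le u v : measurable_fun setT u -> (forall w, 0 <= u w <= v w) ->
  v \in Lfun P p -> u \in Lfun P p.
Proof.
move=> mu uv; rewrite !inE => /andP[_]; rewrite inE/= => fv.
apply/andP; split; rewrite inE//=.
apply: le_lt_trans fv; apply: le_Lnorm => // w /=; rewrite lee_fin.
by have /andP[u0 uvw] := uv w; rewrite !ger0_norm// (le_trans u0).
Qed.

Lemma Lfun_addr u v : u \in Lfun P p -> v \in Lfun P p ->
  (fun w => u w + v w) \in Lfun P p.
Proof. by move=> uL vL; have [_ LD] := Lfun_addr_closed P p1'; exact: LD. Qed.

(** The instance of the maximal inequality in which every sample is [u]. *)
Lemma dominated_Lfun (G : set (set Omega)) u v :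
  sigma_algebra setT G -> G `<=` measurable ->
  measurable_fun setT (u : g_sigma_algebraType G -> R) ->
  (forall w, 0 <= u w) -> (forall w, 0 <= v w) -> v \in Lfun P p ->
  (forall A, G A -> \int[P]_(w in A) (u w)%:E <= \int[P]_(w in A) (v w)%:E)%E ->
  u \in Lfun P p.
Proof.
move=> Gsig Gm mu u0 v0 vL uv; rewrite inE; apply/andP; split; rewrite inE/=.
  exact: measurable_sub_fun mu.
apply: (@limsup_maximal_Lnorm _ _ _ P (fun _ _ => G) (fun _ _ => u) (fun=> 1%N) v)
  => // [k j //|w c /=].
by rewrite lte_fin => cu; apply: nearW => k; exists 0%N.
Qed.

Lemma Lfun_integrable_rV X : (forall i, measurable_fun setT (fun w => X w ord0 i)) ->
  (fun w => l1norm (X w)) \in Lfun P p -> integrable_rV P X.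
Proof.
move=> mX lX i.
have /Lfun1_integrable iX : (fun w => l1norm (X w)) \in Lfun P 1.
  by apply: (Lfun_subset _ p1') lX => //; exact: fin_num_measure.
apply: (le_integrable measurableT _ _ iX); first exact/measurable_EFinP.
move=> w _ /=; rewrite lee_fin [leRHS]ger0_norm ?l1norm_ge0//.
by rewrite /l1norm (bigD1 i)//= lerDl sumr_ge0.
Qed.

Lemma Lfun_l1normB X Y : (forall i, measurable_fun setT (fun w => X w ord0 i)) ->
  (forall i, measurable_fun setT (fun w => Y w ord0 i)) ->
  (fun w => l1norm (X w)) \in Lfun P p -> (fun w => l1norm (Y w)) \in Lfun P p ->
  (fun w => l1norm (X w - Y w)) \in Lfun P p.
Proof.
move=> mX mY lX lY; apply: Lfun_le (Lfun_addr lX lY).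
  apply: measurable_l1norm => i.
  by under [X in measurable_fun _ X]eq_fun do rewrite !mxE; exact: measurable_funB.
by move=> w; rewrite l1norm_ge0 l1normB.
Qed.

Lemma Lfun_l1normD X Y : (forall i, measurable_fun setT (fun w => X w ord0 i)) ->
  (forall i, measurable_fun setT (fun w => Y w ord0 i)) ->
  (fun w => l1norm (X w)) \in Lfun P p -> (fun w => l1norm (Y w)) \in Lfun P p ->
  (fun w => l1norm (X w + Y w)) \in Lfun P p.
Proof.
move=> mX mY lX lY; apply: Lfun_le (Lfun_addr lX lY).
  apply: measurable_l1norm => i.
  by under [X in measurable_fun _ X]eq_fun do rewrite !mxE; exact: measurable_funD.
by move=> w; rewrite l1norm_ge0 l1normD.
Qed.

(** A class of random vectors or of processes is accessed through an honest
    representative; the canonical one is only almost surely equal to it. *)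
Lemma Lp_rep G (V : rvec P n) : G `<=` measurable -> Lp G p V ->
  exists X, [/\ sub_measurable G X, (fun w => l1norm (X w)) \in Lfun P p,
    integrable_rV P X & {ae P, forall w, X w = V w}].
Proof.
move=> Gm [X [GX fX] XV]; have mX i := sub_measurable_fun i Gm GX.
have lX := l1norm_Lfun p1' mX fX.
by exists X; split => //; [exact: Lfun_integrable_rV|exact: rvec_class_ae].
Qed.

Lemma rvec_class_Lp G X : sub_measurable G X ->
  (fun w => l1norm (X w)) \in Lfun P p -> Lp G p (rvec_class P X).
Proof.
by move=> GX lX; exists X => //; split => //; exact: (Lfun_enorm p0 _ lX).
Qed.

Lemma process_class_ae {T : R} (X : R -> Omega -> 'rV[R]_n) (Y : process P T n) :
  process_class P T X = Y ->
  {ae P, forall w, forall t, 0 <= t <= T -> X t w = Y t w}.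
Proof. by move=> XY; apply/process_classP; rewrite process_classK. Qed.

Lemma Sp_rep {T : R} {FF : R -> set (set Omega)} (Y : process P T n) :
  usual_filtration P T FF -> Sp FF p Y ->
  exists Z, [/\ process_class P T Z = Y, forall w, rcll T (Z^~ w), adapted T FF Z &
    forall t, 0 <= t <= T -> [/\ (fun w => l1norm (Z t w)) \in Lfun P p,
      integrable_rV P (Z t) & {ae P, forall w, Z t w = Y t w}]].
Proof.
move=> hFF [X [rX aX fX] XY]; exists X; split => // t tT.
have mX i := sub_measurable_fun i (filtration_measurable hFF tT) (aX t tT).
have lX : (fun w => l1norm (X t w)) \in Lfun P p.
  apply: (l1norm_Lfun p1' mX); apply: le_lt_trans fX.
  apply: le_Lnorm => // w /=.
  have Xs : ((enorm (X t w))%:E <= sup_enorm T X w)%E.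
    by apply: ereal_sup_ubound; exists t.
  rewrite [leRHS]gee0_abs; last by apply: le_trans Xs; rewrite lee_fin enorm_ge0.
  by rewrite ger0_norm ?enorm_ge0.
split => //; first exact: Lfun_integrable_rV.
by apply: filterS (process_class_ae XY) => w; exact.
Qed.

End Lp_spaces.

(** * Fixed points and solutions *)

Section bse_and_fixed_points.
Context {R : realType} {d : measure_display} {Omega : measurableType d}
  {P : probability Omega R} {T : R} {FF : R -> set (set Omega)} {n : nat}
  {p : \bar R} {xi : rvec P n}
  {F : process P T n * process P T n -> process P T n}
  {MV : rvec P n -> process P T n}.
Hypothesis T0 : 0 <= T.
Hypothesis hFF : usual_filtration P T FF.
Hypothesis p1 : (1 < p)%E.
Hypothesis hxi : Lp (FF T) p xi.
Hypothesis hF : set_fun (Sp FF p `*` Mp0 FF p) (Sp0 FF p) F.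
Hypothesis hfwd : forall y M, Lp (FF 0) p y -> Mp0 FF p M ->
  exists! Y, forward_solution FF p F y M Y.
Hypothesis hMV : forall V, Lp (FF T) p V -> is_MV FF V (MV V).

Local Notation phi := (phi_map FF p F MV).
Local Notation G := (G_map FF p F xi MV).
Local Notation pi := (@pi_map R d Omega P n T).
Local Notation BSE := (bse_solution FF p F xi).
Local Notation LT := (Lp (FF T) p : set (rvec P n)).
Local Notation E t V := (condexp (FF t) V).

Let FS t (tT : 0 <= t <= T) : complete_sub_sigma_algebra P (FF t) :=
  filtration_complete hFF tT.
Let Fm t (tT : 0 <= t <= T) : FF t `<=` measurable := filtration_measurable hFF tT.
Let T00 : 0 <= (0 : R) <= T. Proof. by rewrite lexx. Qed.
Let TTT : 0 <= T <= T. Proof. by rewrite lexx T0. Qed.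

Lemma LT_integrable V : LT V -> integrable_rV P V.
Proof.
move=> /(Lp_rep p1 (Fm TTT))[X [_ _ iX XV]].
exact: integrable_rV_ae (FS TTT) _ _ XV iX.
Qed.

Lemma LT_sub_measurable V : LT V -> sub_measurable (FF T) V.
Proof.
move=> /(Lp_rep p1 (Fm TTT))[X [GX _ _ XV]]; have [Gsig _ Gneg] := FS TTT.
exact: (sub_measurable_ae Gsig Gneg XV GX).
Qed.

(** [V] is measurable with respect to [FF T], hence is its own conditional
    expectation. *)
Lemma condexp_T V : LT V -> {ae P, forall w, E T V w = V w}.
Proof.
move=> LV; have iV := LT_integrable LV.
apply: (condexp_ae (FS TTT)) => //.
by apply: is_condexp_id => //; exact: LT_sub_measurable.
Qed.

Lemma condexp0_Lfun V : LT V -> (fun w => l1norm (E 0 V w)) \in Lfun P p.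
Proof.
move=> LV; have iV := LT_integrable LV.
have [X [_ lX iX XV]] := Lp_rep p1 (Fm TTT) LV.
have [Gsig Gm _] := FS T00; have EV := condexpP (FS T00) iV.
apply: (dominated_Lfun p1 Gsig Gm _ _ _ lX) => [|w|w|A GA].
- by apply: measurable_l1norm; apply/(sub_measurableP Gsig); case: EV.
- exact: l1norm_ge0.
- exact: l1norm_ge0.
- apply: (condexp_l1_contract (FS T00)) => //.
  apply: (is_condexp_ae (FS T00)) EV => //; last exact: aeW.
  by apply: filterS XV => w.
Qed.

Lemma condexp0_Lp V : LT V -> Lp (FF 0) p (E 0 V).
Proof.
move=> LV; rewrite -(rvec_classK (E 0 V)); apply: (rvec_class_Lp p1).
  by have [] := condexpP (FS T00) (LT_integrable LV).
exact: condexp0_Lfun.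
Qed.

(** The martingale property is the tower property.  For the norm, the value at
    time [t] is the conditional expectation of the terminal value
    [E_0 V - V], which lies in L^p by the contraction property; Doob's
    inequality then bounds the supremum over time. *)
Lemma MV_Mp0 V : LT V -> Mp0 FF p (MV V).
Proof.
move=> LV; have iV := LT_integrable LV.
have [X [GX lX iX XV]] := Lp_rep p1 (Fm TTT) LV.
have [[Z [rZ aZ] ZM] MVt] := hMV LV.
have ZE t : 0 <= t <= T -> {ae P, forall w, E 0 V w - E t V w = Z t w}.
  move=> tT; apply: filterS2 (process_class_ae ZM) (MVt t tT) => w ZMw MVw.
  by rewrite ZMw.
have iE t : 0 <= t <= T -> integrable_rV P (E t V).
  by move=> tT; have [] := condexpP (FS tT) iV.
have ZC s t : 0 <= s -> s <= t -> t <= T -> is_condexp P (FF s) (Z t) (Z s).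
  move=> s0 st tT; have sT' : 0 <= s <= T by rewrite s0 (le_trans st).
  have tT' : 0 <= t <= T by rewrite tT (le_trans s0).
  apply: (is_condexp_ae (FS sT') _ (ZE t tT') (ZE s sT')).
    exact: integrable_rVB (iE _ T00) (iE _ tT').
  apply: (is_condexpB (FS sT')); try exact: iE.
    apply: is_condexp_id; last exact: iE.
    have [G0 _ _] := condexpP (FS T00) iV.
    move=> i; apply: subset_trans (G0 i) _.
    by apply: (filtration_mono hFF) => //; case/andP: sT'.
  have [Gs is_ Es] := condexpP (FS sT') iV; have [_ _ Et] := condexpP (FS tT') iV.
  split => // i A GA; rewrite Es// Et//.
  exact: (filtration_mono hFF) GA.
split; last by exists Z => // s t; exact: ZC.
split.
  exists Z => //; split => //.
  have mE i : measurable_fun setT (fun w => E 0 V w ord0 i).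
    exact: integrable_rV_measurable (iE _ T00) i.
  have mX i := sub_measurable_fun i (Fm TTT) GX.
  apply: (rcll_dominated_sup T0 hFF p1 rZ aZ
    (Lfun_l1normB p1 mE mX (condexp0_Lfun LV) lX)) => [w|t A tT FA].
    exact: l1norm_ge0.
  apply: (condexp_l1_contract (FS tT)) => //.
    exact: integrable_rVB (iE _ T00) iX.
  have /andP[t0 tT'] := tT.
  have iZ : integrable_rV P (Z T) by have [_ + _] := ZC _ _ T0 (lexx T) (lexx T).
  apply: (is_condexp_ae (FS tT) iZ _ _ (ZC _ _ t0 tT' (lexx T))); last exact: aeW.
  apply: filterS3 (ZE _ TTT) (condexp_T LV) XV => w <- -> ->//.
by apply: filterS (MVt 0 T00) => w ->; rewrite subrr.
Qed.

Lemma YV_forward V : LT V -> forward_solution FF p F (E 0 V) (MV V) (YV FF p F MV V).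
Proof.
move=> LV; apply: xgetPex.
by have [Y [hY _]] := hfwd (condexp0_Lp LV) (MV_Mp0 LV); exists Y.
Qed.

Lemma phi_SM V : LT V -> (Sp FF p `*` Mp0 FF p) (phi V).
Proof. by move=> LV; split => /=; [have [] := YV_forward LV|exact: MV_Mp0]. Qed.

Lemma F0_ae YM : (Sp FF p `*` Mp0 FF p) YM -> {ae P, forall w, F YM 0 w = 0}.
Proof. by move=> /hF[]. Qed.

(** At time 0 both [F] and the martingale vanish, so the solution starts from
    [E_0 V], while the martingale ends at [E_0 V - V]. *)
Lemma pi_phi V : LT V -> pi (phi V) = V.
Proof.
move=> LV; rewrite -[RHS]rvec_classK; apply/rvec_classP => /=.
have [_ Yf] := YV_forward LV; have [_ MVt] := hMV LV.
have [[_ M0] _] := MV_Mp0 LV.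
have F0 := F0_ae (phi_SM LV).
have h1 := ae_and F0 M0.
have h2 := ae_and (MVt T TTT) (condexp_T LV).
apply: filterS3 h1 h2 Yf => w [F0w M0w] [-> ->] /(_ 0 T00) ->.
by rewrite M0w F0w !subr0 opprB addrC subrK.
Qed.

Lemma pi_LT YM : (Sp FF p `*` Mp0 FF p) YM -> LT (pi YM).
Proof.
move=> [/= /(Sp_rep p1 hFF)[Y [YE _ aY lY]] [[/(Sp_rep p1 hFF)[M [ME _ aM lM]] _] _]].
have [lY0 _ Y0] := lY 0 T00; have [lMT _ MT] := lM T TTT.
have sY0 : sub_measurable (FF T) (Y 0).
  move=> i; apply: subset_trans (aY 0 T00 i) _.
  exact: (filtration_mono hFF).
have -> : pi YM = rvec_class P (fun w => Y 0 w - M T w).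
  by apply/rvec_classP; apply: filterS2 Y0 MT => w -> ->.
apply: (rvec_class_Lp p1).
  by apply: (sub_measurableB (FS TTT)) => //; exact: aM.
apply: (Lfun_l1normB p1) => // i; apply: sub_measurable_fun _ (Fm TTT) _.
  exact: sY0.
exact: aM.
Qed.

Lemma G_LT V : LT V -> LT (G V).
Proof.
move=> LV; have [X [GX lX iX XV]] := Lp_rep p1 (Fm TTT) hxi.
have [/(Sp_rep p1 hFF)[Z [ZE _ aZ lZ]] _] := hF (phi_SM LV).
have [lZT _ ZT] := lZ T TTT.
have -> : G V = rvec_class P (fun w => X w + Z T w).
  by apply/rvec_classP; apply: filterS2 XV ZT => w -> ->.
have sZ := aZ T TTT.
apply: (rvec_class_Lp p1); first exact: (sub_measurableD (FS TTT)).
by apply: (Lfun_l1normD p1) => // i; exact: sub_measurable_fun (Fm TTT) _.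
Qed.

Lemma fixed_point_bse V : LT V -> G V = V -> BSE (phi V).
Proof.
move=> LV GV; split; first exact: phi_SM.
have {}GV : {ae P, forall w, xi w + F (phi V) T w = V w} by exact: rvec_class_ae GV.
have [_ Yf] := YV_forward LV; have [_ MVt] := hMV LV.
have h := ae_and (MVt T TTT) (condexp_T LV).
apply: filterS3 GV h Yf => w GVw [MTw ETw] Yw t tT /=.
rewrite Yw// [LHS]addrAC subrK subrK GVw MTw ETw.
by rewrite addrC subrK.
Qed.

(** With [V] the class of [Y_0 - M_T], the martingale property gives
    [E_t V = Y_0 - M_t], so [M] is an RCLL version of [E_0 V - E_t V] and
    therefore is [MV V].  The equation at time 0 reads
    [Y_0 = xi + F_T + M_T]: this is the fixed-point property, and it turns the
    equation at time [t] into the forward equation with initial value [Y_0],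
    whose only solution is [Y]. *)
Lemma bse_fixed_point YM : BSE YM ->
  [/\ LT (pi YM), G (pi YM) = pi YM & YM = phi (pi YM)].
Proof.
case: YM => Y M [SM eqn]; have LV := pi_LT SM; have F0 := F0_ae SM.
set V := pi (Y, M); rewrite -/V in LV.
have [/= SY MM] := SM; have [[SMM M0] [X2 mX2 X2M]] := MM.
have [Y1 [Y1E rY1 aY1 lY1]] := Sp_rep p1 hFF SY.
have [X1 [X1E rX1 aX1 lX1]] := Sp_rep p1 hFF SMM.
have X2t := process_class_ae X2M.
have [_ iY0 Y10] := lY1 0 T00.
have iV := LT_integrable LV.
have iX2 t : 0 <= t <= T -> integrable_rV P (X2 t).
  by move=> /andP[t0 tT]; have [] := mX2 _ _ t0 (lexx t) tT.
have VE : {ae P, forall w, Y1 0 w - X2 T w = V w}.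
  apply: (rvec_class_ae (X := fun w => Y1 0 w - X2 T w)); apply/rvec_classP.
  by apply: filterS2 Y10 X2t => w -> /(_ T TTT) ->.
have EV t : 0 <= t <= T -> {ae P, forall w, E t V w = Y1 0 w - X2 t w}.
  move=> tT; have /andP[t0 tT'] := tT; apply: (condexp_ae (FS tT) iV).
  apply: (is_condexp_ae (FS tT) _ VE (aeW _ (fun=> erefl))).
    exact: integrable_rVB iY0 (iX2 _ TTT).
  apply: (is_condexpB (FS tT)) => //; first exact: iX2.
    apply: is_condexp_id => // i; apply: subset_trans (aY1 0 T00 i) _.
    exact: (filtration_mono hFF).
  exact: mX2.
have E0V : {ae P, forall w, E 0 V w = Y 0 w}.
  have h := ae_and Y10 M0.
  apply: filterS3 (EV 0 T00) h X2t => w -> [-> M0w] /(_ 0 T00) ->.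
  by rewrite M0w subr0.
have MVM : MV V = M.
  have [[Z [rZ aZ] ZM] MVt] := hMV LV.
  rewrite -ZM -X1E; apply/process_classP.
  apply: (rcll_modification_indist T0) => // t tT.
  have [_ _ X1t] := lX1 t tT.
  have h1 := ae_and (process_class_ae ZM) (MVt t tT).
  have h2 := ae_and (EV 0 T00) (EV t tT).
  have h3 := ae_and X2t M0.
  have h4 := ae_and h3 X1t.
  apply: filterS3 h1 h2 h4 => w [Zw MVw] [E0w Etw] [[X2w M0w] X1w].
  rewrite Zw// MVw E0w Etw X1w (X2w 0 T00) M0w subr0 opprB addrCA subrr addr0.
  exact: X2w.
have YF : forward_solution FF p F (E 0 V) (MV V) Y.
  split => //; rewrite MVM.
  have h := ae_and F0 M0.
  apply: filterS3 h eqn E0V => w [F0w M0w] eqnw E0w t tT.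
  have := eqnw 0 T00; rewrite /= F0w M0w !addr0 -(eqnw t tT)/= E0w => ->.
  by rewrite addrAC addrK addrK.
have YE : YV FF p F MV V = Y.
  have [Y' [_ uY']] := hfwd (condexp0_Lp LV) (MV_Mp0 LV).
  by rewrite -(uY' _ YF) -(uY' _ (YV_forward LV)).
have phiE : phi V = (Y, M) by rewrite /phi_map YE MVM.
split => //.
rewrite -{2}(rvec_classK V) /G_map YE MVM.
have h := ae_and F0 M0.
have VE' : {ae P, forall w, Y 0 w - M T w = V w} by exact: rvec_class_ae.
apply/rvec_classP; apply: filterS3 h eqn VE' => w [F0w M0w] eqnw <-.
have := eqnw 0 T00; rewrite /= F0w M0w !addr0 => ->.
by rewrite addrK.
Qed.

End bse_and_fixed_points.

Theorem theorem2p3 (R : realType) (dsp : measure_display)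
    (Omega : measurableType dsp) (P : probability Omega R)
    (T : R) (FF : R -> set (set Omega)) (n : nat) (p : \bar R)
    (xi : rvec P n)
    (F : process P T n * process P T n -> process P T n)
    (MV : rvec P n -> process P T n)
    (T_ge0 : 0 <= T)
    (hFF : usual_filtration P T FF)
    (p_gt1 : (1 < p)%E)
    (hxi : Lp (FF T) p xi)
    (hF : set_fun (Sp FF p `*` Mp0 FF p) (Sp0 FF p) F)
    (hfwd : forall y M, Lp (FF 0) p y -> Mp0 FF p M ->
       exists! Y, forward_solution FF p F y M Y)
    (hMV : forall V, Lp (FF T) p V -> is_MV FF V (MV V)) :
  let LT := Lp (FF T) p : set (rvec P n) in
  let SM := (Sp FF p `*` Mp0 FF p) : set (process P T n * process P T n) in
  let G := G_map FF p F xi MV in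
  let phi := phi_map FF p F MV in
  let pi := @pi_map R dsp Omega P n T in
  let BSE := bse_solution FF p F xi in
  [/\ set_fun LT LT G, set_fun SM LT pi & set_fun LT SM phi] /\
  [/\ (forall V, LT V -> V = pi (phi V)) /\ set_inj LT phi,
      forall V, LT V -> G V = V -> BSE (phi V),
      forall YM, BSE YM ->
        [/\ LT (pi YM), G (pi YM) = pi YM & YM = phi (pi YM)] &
      forall V, LT V ->
        (unique [set V' | LT V' /\ G V' = V'] V <-> unique BSE (phi V))].
Proof.
move=> LT SM G phi pi BSE.
have aV V : LT V -> pi (phi V) = V by exact: pi_phi.
have inj V V' : LT V -> LT V' -> phi V = phi V' -> V = V'.
  by move=> LV LV' E; rewrite -(aV V)// E aV.
have bV V : LT V -> G V = V -> BSE (phi V) by exact: fixed_point_bse.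
have cYM YM : BSE YM -> [/\ LT (pi YM), G (pi YM) = pi YM & YM = phi (pi YM)].
  exact: bse_fixed_point.
split; [split; [exact: G_LT|exact: pi_LT|exact: phi_SM]|split => //].
  split; first by move=> V LV; rewrite aV.
  by move=> V V' /set_mem LV /set_mem LV'; exact: inj.
move=> V LV; split=> [[[_ GV] uV]|[BV uB]].
  split=> [|YM /cYM[LYM GYM ->]]; first exact: bV.
  by rewrite (uV (pi YM)).
split=> [|V' [LV' GV']]; first by have [] := cYM _ BV; rewrite aV.
by apply: inj => //; apply: uB; exact: bV.
Qed.
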